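(* Let $i_1,\ldots,i_n$ be positive integers ($n\ge1$). Then $$\mathrm{ct}(i_1,\ldots,i_n)\ \ge\ i_1+2\,i_2+\cdots+n\,i_n+(n+1).$$ If $i_1,\ldots,i_n$ are not all equal, then $$\mathrm{ct}(i_1,\ldots,i_n)\ \ge\ i_1+2\,i_2+\cdots+n\,i_n+(n+2).$$
   Context: An open cover $\mathcal U$ of a space $Y$ is a good cover if all elements of $\mathcal U$ and all their non-empty finite intersections are contractible. The strict covering type $\mathrm{sct}(Y)$ is the minimal cardinality of a good cover of $Y$, and the covering type of a space $X$ is $\mathrm{ct}(X):=\min\{\mathrm{sct}(Y)\mid Y\simeq X\}$. All spaces considered are assumed to admit finite good covers and to have the homotopy type of a finite CW complex. A space $X$ admits an essential $(i_1,\ldots,i_n)$-product if there are cohomology classes $x_k\in H^{i_k}(X)$ (with coefficients in some commutative ring, which may be arbitrary) such that the product $x_1\cdot x_2\cdots x_n$ is non-trivial. The covering type of the $n$-tuple is $$\mathrm{ct}(i_1,\ldots,i_n):=\min\{\mathrm{ct}(X)\mid X \text{ admits an essential } (i_1,\ldots,i_n)\text{-product}\}.$$ *)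

(* Defs.v *)
From HB Require Import structures.
From mathcomp Require Import all_boot all_order all_algebra.
From mathcomp Require Import all_classical all_reals.
From mathcomp Require Import ereal topology normedtype.

Set Implicit Arguments.
Unset Strict Implicit.
Unset Printing Implicit Defensive.

Import Order.TTheory GRing.Theory Num.Theory.
Import numFieldNormedType.Exports.

Local Open Scope classical_set_scope.
Local Open Scope ring_scope.

(** * Homotopy *)

(* Only the values of [H] on X x [0, 1] matter; any continuous map on
   X x [0, 1] extends to such an [H]. *)
Definition homotopic (R : realType) (X Y : topologicalType) (f g : X -> Y) :=
  exists H : X * R -> Y,
    [/\ {within [set: X] `*` `[0, 1], continuous H},
        forall x, H (x, 0) = f x & forall x, H (x, 1) = g x].

Definition homotopy_equivalent (R : realType) (X Y : topologicalType) :=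
  exists (f : X -> Y) (g : Y -> X),
    [/\ continuous f, continuous g,
        homotopic R (g \o f) id & homotopic R (f \o g) id].

Definition contractible (R : realType) (X : topologicalType) :=
  exists x0 : X, homotopic R (@id X) (fun=> x0).

(** * Finite CW complexes *)

(* The topology of 'rV[R]_n is the product topology. *)
Definition disc (R : realType) (n : nat) : set 'rV[R]_n :=
  [set x | \sum_j x ord0 j ^+ 2 <= 1].
Arguments disc : clear implicits.

Definition disc_interior (R : realType) (n : nat) : set (disc R n) :=
  [set u | \sum_j (\val u : 'rV[R]_n) ord0 j ^+ 2 < 1].

(* Whitehead's definition, in the finite case: a Hausdorff space with finitely
   many characteristic maps, the images of the open discs partitioning the
   space, and boundaries of cells lying in cells of smaller dimension.  For
   finitely many cells, the closure-finiteness and weak topology conditions are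
   automatic. *)
Definition finite_CW (R : realType) (X : topologicalType) :=
  hausdorff_space X /\
  exists (N : nat) (d : 'I_N -> nat)
         (phi : forall c : 'I_N, continuousType (disc R (d c)) X),
    set_bij [set u : {c : 'I_N & disc R (d c)} | disc_interior (projT2 u)]
            [set: X] (fun u => phi (projT1 u) (projT2 u)) /\
    forall (c : 'I_N) (u : disc R (d c)), ~ disc_interior u ->
      exists (c' : 'I_N) (v : disc R (d c')),
        [/\ (d c' < d c)%N, disc_interior v & phi c' v = phi c u].

(** * Good covers *)

Definition good_cover (R : realType) (Y : topologicalType) (U : set (set Y)) :=
  [/\ forall A, U A -> open A,
      \bigcup_(A in U) A = [set: Y],
      forall A, U A -> contractible R A &
      forall V : set (set Y), V `<=` U -> finite_set V -> V !=set0 ->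
        \bigcap_(A in V) A !=set0 -> contractible R (\bigcap_(A in V) A)].

Definition admissible (R : realType) (X : topologicalType) :=
  (exists U : set (set X), finite_set U /\ good_cover R U) /\
  (exists2 W : topologicalType, finite_CW R W & homotopy_equivalent R X W).

(* The minima defining the covering types are those of sets of natural numbers,
   so they are expressed as infima in the extended reals: such an infimum is
   attained as soon as the set is nonempty, and is +oo otherwise. *)

Definition sct (R : realType) (Y : topologicalType) : \bar R :=
  ereal_inf [set e | exists (U : set (set Y)) (k : nat),
                       [/\ good_cover R U, (U #= `I_k)%card & e = (k%:R)%:E]].

Definition ct (R : realType) (X : topologicalType) : \bar R :=
  ereal_inf [set e | exists Y : topologicalType,
                       [/\ admissible R Y, homotopy_equivalent R Y X
                         & e = sct R Y]].

(** * Singular cohomology and cup products *)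

Definition std_simplex (R : realType) (n : nat) : set 'rV[R]_n.+1 :=
  [set t | (forall j, 0 <= t ord0 j) /\ \sum_j t ord0 j = 1].
Arguments std_simplex : clear implicits.

(* The affine map sending the vertex i of the simplex to its vertex a i. *)
Definition vertex_map_row (R : realType) (m n : nat)
    (a : 'I_m.+1 -> 'I_n.+1) (t : 'rV[R]_m.+1) : 'rV[R]_n.+1 :=
  \row_j \sum_(i | a i == j) t ord0 i.

Lemma vertex_map_subproof (R : realType) (m n : nat)
    (a : 'I_m.+1 -> 'I_n.+1) (t : std_simplex R m) :
  vertex_map_row a (\val t) \in std_simplex R n.
Proof.
case: t => t /=; rewrite !inE => -[t0 t1]; split.
  by move=> j; rewrite mxE; apply: sumr_ge0.
rewrite -t1 [RHS](partition_big a xpredT) //=.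
by apply: eq_bigr => j _; rewrite mxE.
Qed.

Definition vertex_map (R : realType) (m n : nat) (a : 'I_m.+1 -> 'I_n.+1)
    (t : std_simplex R m) : std_simplex R n :=
  exist _ (vertex_map_row a (\val t)) (vertex_map_subproof a t).

Lemma vertex_map_row_continuous (R : realType) (m n : nat)
    (a : 'I_m.+1 -> 'I_n.+1) : continuous (@vertex_map_row R m n a).
Proof.
move=> t A [P Pn sPA].
have coord k j : (fun u : 'rV[R]_m.+1 => \sum_(i | a i == j) u ord0 i) @ t -->
    vertex_map_row a t k j.
  rewrite mxE; apply: (@cvg_big _ _ _ _ _ _ _ (nbhs t)) => [|i _].
    exact: add_continuous.
  exact: coord_continuous.
have near_P : nbhs t [set u | forall k j, P k j (vertex_map_row a u k j)].
  apply: (@filter_forall _ _ (fun k u => forall j,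
    P k j (vertex_map_row a u k j)) (nbhs t)) => k.
  apply: (@filter_forall _ _ (fun j u =>
    P k j (vertex_map_row a u k j)) (nbhs t)) => j.
  have := coord k j _ (Pn k j); apply: (@filterS _ (nbhs t)) => u /=.
  by rewrite mxE.
by move: near_P; apply: (@filterS _ (nbhs t)) => u Pu; apply: sPA.
Qed.

Lemma vertex_map_continuous (R : realType) (m n : nat)
    (a : 'I_m.+1 -> 'I_n.+1) : continuous (@vertex_map R m n a).
Proof.
apply/continuousP => B [C oC <-].
exists (@vertex_map_row R m n a @^-1` C) => //.
by apply: open_comp => // x _; apply: vertex_map_row_continuous.
Qed.

HB.instance Definition _ (R : realType) (m n : nat)
    (a : 'I_m.+1 -> 'I_n.+1) :=
  isContinuous.Build _ _ (@vertex_map R m n a) (@vertex_map_continuous R m n a).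

Definition singular (R : realType) (X : topologicalType) (n : nat) :=
  continuousType (std_simplex R n) X.

Definition singular_map (R : realType) (X : topologicalType) (m n : nat)
    (a : 'I_m.+1 -> 'I_n.+1) (s : singular R X n) : singular R X m :=
  s \o @vertex_map R m n a.

Definition cochain (R : realType) (K : comPzRingType) (X : topologicalType)
    (n : nat) :=
  singular R X n -> K.

Definition coboundary (R : realType) (K : comPzRingType) (X : topologicalType)
    (n : nat) (c : cochain R K X n) : cochain R K X n.+1 :=
  fun s => \sum_(j < n.+2) (-1) ^+ j * c (singular_map (lift j) s).

Definition is_cocycle (R : realType) (K : comPzRingType) (X : topologicalType)
    (n : nat) (c : cochain R K X n) :=
  forall s, coboundary c s = 0.

Definition is_coboundary (R : realType) (K : comPzRingType)
    (X : topologicalType) (n : nat) : cochain R K X n -> Prop :=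
  match n with
  | 0 => fun c => forall s, c s = 0
  | m.+1 => fun c => exists b : cochain R K X m, forall s, c s = coboundary b s
  end.

(* Front p-face and back q-face of a (p + q)-simplex. *)
Definition cup (R : realType) (K : comPzRingType) (X : topologicalType)
    (p q : nat) (b : cochain R K X p) (c : cochain R K X q) :
    cochain R K X (p + q) :=
  fun s => b (singular_map (fun i : 'I_p.+1 => inord i) s) *
           c (singular_map (fun i : 'I_q.+1 => inord (p + i)) s).

(* x 0, x 1, ... have degrees i_1, i_2, ...; the values of x beyond the length
   of the sequence are irrelevant. *)
Fixpoint cup_prod (R : realType) (K : comPzRingType) (X : topologicalType)
    (i : seq nat) :
    (forall k : nat, cochain R K X (nth 0%N i k)) -> cochain R K X (sumn i) :=
  match i return (forall k : nat, cochain R K X (nth 0%N i k)) ->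
                 cochain R K X (sumn i) with
  | [::] => fun _ _ => 1
  | _ :: i' => fun x => cup (x 0%N) (@cup_prod R K X i' (fun k => x k.+1))
  end.

(* The cohomology classes are given by representing cocycles: the class of the
   cup product of the cocycles is the product of their classes, and it is
   nontrivial when it is not represented by a coboundary. *)
Definition essential_product (R : realType) (X : topologicalType)
    (i : seq nat) :=
  exists (K : comPzRingType) (x : forall k : nat, cochain R K X (nth 0%N i k)),
    (forall k : nat, (k < size i)%N -> is_cocycle (x k)) /\
    ~ is_coboundary (cup_prod x).

Definition ct_tuple (R : realType) (i : seq nat) : \bar R :=
  ereal_inf [set e | exists X : topologicalType,
                       [/\ admissible R X, essential_product R X i
                         & e = ct R X]].

(* Main.v *)
(* Only the nerve of the good cover matters, through three facts, all obtained
   from Mayer-Vietoris by induction on the number of sets: a subfamily with a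
   common point has an acyclic union; if the union has cohomology in degree m,
   then some m + 1 members have a common point; and if b + 2 members have a union
   with cohomology in degree b > 0, then this union has no cohomology in other
   positive degrees.

   Given an essential product x_1 ... x_n of total degree m, pick m + 1 members
   with a common point.  Every x_k vanishes on their union V, so by the relative
   cup product x_2 ... x_n and x_1 ... x_(n-1) are both essential on the union W
   of the remaining members.  Dropping the first class repeatedly gives the first
   bound.

   For the second bound, peel off first classes until the degrees are
   (a, b, ..., b) with a <> b.  One more step leaves a family on which both
   (b, ..., b) and (a, b, ..., b) are essential.  Shorten the first product from
   the left and the second one from the right, removing the same members: in the
   end a single family has cohomology in degrees a and b, so that it cannot have
   only b + 2 members. *)
From HB Require Import structures.
Require Import Defs.
From mathcomp Require Import all_boot all_order all_algebra.
From mathcomp Require Import all_classical all_reals.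
From mathcomp Require Import ereal topology normedtype sequences.
From mathcomp Require Import ring zify.

Set Implicit Arguments.
Unset Strict Implicit.
Unset Printing Implicit Defensive.

Import Order.TTheory GRing.Theory Num.Theory.
Import numFieldNormedType.Exports.

Local Open Scope classical_set_scope.
Local Open Scope ring_scope.

(** * Subdivision, prisms and cup products on lists of points *)

Section ListCochains.
Variables (K : comPzRingType).

(* A list of points stands for the affine simplex with these vertices, and a
   function [seq P -> K] for a cochain; [ldelta], [sd], [sdh] and [prism] are the
   transposes of the boundary, of barycentric subdivision, of the homotopy from
   it to the identity, and of the prism operator.  The empty list is a simplex of
   dimension -1, so the complex is augmented. *)
Fixpoint ldelta (P : Type) (phi : seq P -> K) (l : seq P) : K :=
  if l is a :: l' then phi l' - ldelta (fun m => phi (a :: m)) l' else 0.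

Definition rem_nth (P : Type) (j : nat) (l : seq P) := take j l ++ drop j.+1 l.

Lemma ldeltaE (P : Type) (phi : seq P -> K) (l : seq P) :
  ldelta phi l = \sum_(j < size l) (-1) ^+ j * phi (rem_nth j l).
Proof.
elim: l phi => [|a l IH] phi /=; first by rewrite big_ord0.
rewrite big_ord_recl expr0 mul1r /rem_nth /= drop0; congr (_ + _).
rewrite IH -sumrN; apply: eq_bigr => j _.
by rewrite /bump add1n exprS mulN1r mulNr.
Qed.

Lemma size_rem_nth (P : Type) j (l : seq P) : (j < size l)%N ->
  size (rem_nth j l) = (size l).-1.
Proof.
by move=> jl; rewrite /rem_nth size_cat size_take size_drop jl subnS -subn1 addnBA
  ?subn_gt0 // subnKC ?subn1 // ltnW.
Qed.

Lemma eq_ldelta (P : Type) (phi psi : seq P -> K) n l : size l = n.+1 ->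
  (forall m, size m = n -> phi m = psi m) -> ldelta phi l = ldelta psi l.
Proof.
move=> sl eqf; rewrite !ldeltaE; apply: eq_bigr => j _; congr (_ * _).
by apply: eqf; rewrite size_rem_nth // sl.
Qed.

Lemma ldeltaB (P : Type) (phi psi : seq P -> K) l :
  ldelta (fun m => phi m - psi m) l = ldelta phi l - ldelta psi l.
Proof.
by rewrite !ldeltaE -sumrB; apply: eq_bigr => j _; rewrite mulrBr.
Qed.

Lemma ldeltaD (P : Type) (phi psi : seq P -> K) l :
  ldelta (fun m => phi m + psi m) l = ldelta phi l + ldelta psi l.
Proof.
by rewrite !ldeltaE -big_split; apply: eq_bigr => j _; rewrite mulrDr.
Qed.

Lemma ldeltaZ (P : Type) c (phi : seq P -> K) l :
  ldelta (fun m => c * phi m) l = c * ldelta phi l.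
Proof.
by rewrite !ldeltaE mulr_sumr; apply: eq_bigr => j _; rewrite mulrCA.
Qed.

Lemma ldelta_ldelta (P : Type) (phi : seq P -> K) l : ldelta (ldelta phi) l = 0.
Proof.
elim: l phi => //= a l IH phi.
by rewrite ldeltaB IH subr0 subrr.
Qed.

Lemma ldelta_map (P Q : Type) (f : P -> Q) (phi : seq Q -> K) l :
  ldelta phi (map f l) = ldelta (phi \o map f) l.
Proof. by elim: l phi => //= a l IH phi; rewrite IH. Qed.

Lemma ldelta_eq0 (P : Type) (phi : seq P -> K) l :
  (forall m, phi m = 0) -> ldelta phi l = 0.
Proof. by move=> phi0; rewrite ldeltaE big1 // => j _; rewrite phi0 mulr0. Qed.

Section Subdivision.
Variables (P : Type) (bary : seq P -> P).

(** The number [n] is meant to be [size l], one more than the dimension. A simplex is subdivided as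
    the cone, with apex its barycentre, over its subdivided boundary. *)
Fixpoint sd (n : nat) (phi : seq P -> K) (l : seq P) : K :=
  if n is n'.+1 then
    ldelta (sd n' (fun m => phi (bary l :: m))) l
  else phi l.

Fixpoint sdh (n : nat) (phi : seq P -> K) (l : seq P) : K :=
  if n is n'.+1 then
    phi (bary l :: l) - ldelta (sdh n' (fun m => phi (bary l :: m))) l
  else 0.

Lemma sdB n phi psi l :
  sd n (fun m => phi m - psi m) l = sd n phi l - sd n psi l.
Proof.
elim: n phi psi l => //= n IH phi psi l.
by rewrite -ldeltaB; congr (ldelta _ _); apply/funext => m; rewrite IH.
Qed.

Lemma sdhB n phi psi l :
  sdh n (fun m => phi m - psi m) l = sdh n phi l - sdh n psi l.
Proof.
elim: n phi psi l => /= [*|n IH phi psi l]; first by rewrite subrr.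
rewrite [X in ldelta X](_ : _ = fun m => sdh n (fun m => phi (bary l :: m)) m
  - sdh n (fun m => psi (bary l :: m)) m); last by apply/funext => m; rewrite IH.
by rewrite ldeltaB; ring.
Qed.

(** The boundary of the cone over the subdivided boundary is its base, up to cones over the boundary
    of that base; by induction these cancel through [ldelta_ldelta]. *)
Lemma sd_ldelta n phi l : size l = n.+1 ->
  sd n.+1 (ldelta phi) l = ldelta (sd n phi) l.
Proof.
elim: n phi l => [|n IH] phi l sl.
  rewrite /=; case: l sl => [|a [|]] //= _.
  by rewrite !subr0.
transitivity (ldelta (fun m => sd n.+1 phi m
    - sd n.+1 (ldelta (fun m' => phi (bary l :: m'))) m) l).
  by congr (ldelta _ _); apply/funext => m; rewrite -sdB.
rewrite ldeltaB [X in _ - X](_ : _ = 0) ?subr0 //.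
rewrite -[RHS](ldelta_ldelta (sd n (fun m => phi (bary l :: m))) l).
by apply: eq_ldelta sl _ => m sm; rewrite IH.
Qed.

(* The dual of [T d + d T = 1 - Sd]. *)
Lemma sdh_ldelta n phi l : size l = n.+1 ->
  sdh n.+1 (ldelta phi) l + ldelta (sdh n phi) l = phi l - sd n.+1 phi l.
Proof.
elim: n phi l => [|n IH] phi l sl.
  rewrite /=; case: l sl => [|a [|]] //= _.
  by rewrite !subr0 addr0.
pose psi m := phi (bary l :: m).
rewrite [sdh n.+2 _ _]/= -/psi.
rewrite [X in _ - X + _](_ : _ = ldelta (fun m => sdh n.+1 phi m
     - sdh n.+1 (ldelta psi) m) l); last first.
  by congr (ldelta _ _); apply/funext => m; rewrite -sdhB.
rewrite ldeltaB (@eq_ldelta _ (sdh n.+1 (ldelta psi))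
  (fun m => (psi m - sd n.+1 psi m) - ldelta (sdh n psi) m) n.+1) //; last first.
  by move=> m sm; rewrite -IH // addrK.
rewrite !ldeltaB ldelta_ldelta subr0.
rewrite [sd n.+2 _ _]/= -/psi.
ring.
Qed.

Lemma sdh_eq0 n phi l : (forall m, phi m = 0) -> sdh n phi l = 0.
Proof.
elim: n phi l => //= n IH phi l phi0.
by rewrite phi0 ldelta_eq0 ?subrr // => m; rewrite IH.
Qed.

Lemma eq_sd n phi psi l : size l = n ->
  (forall m, size m = n -> phi m = psi m) -> sd n phi l = sd n psi l.
Proof.
elim: n phi psi l => [|n IH] phi psi l sl eqf; first exact: eqf.
apply: eq_ldelta sl _ => m sm; apply: IH => // m' sm'.
by apply: eqf; rewrite /= sm'.
Qed.

Fixpoint sd_iter (n i : nat) (phi : seq P -> K) : seq P -> K :=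
  if i is i'.+1 then sd_iter n i' (sd n phi) else phi.

Lemma eq_sd_iter n i phi psi l : size l = n ->
  (forall m, size m = n -> phi m = psi m) ->
  sd_iter n i phi l = sd_iter n i psi l.
Proof.
elim: i phi psi => [|i IH] phi psi sl eqf; first exact: eqf.
by apply: IH => // m sm; apply: eq_sd.
Qed.

Lemma sd_iterB n i phi psi l :
  sd_iter n i (fun m => phi m - psi m) l = sd_iter n i phi l - sd_iter n i psi l.
Proof.
elim: i phi psi => //= i IH phi psi.
by rewrite -IH; congr (sd_iter _ _ _ _); apply/funext => m; rewrite sdB.
Qed.

Lemma sd_iter_ldelta n i phi l : size l = n.+1 ->
  sd_iter n.+1 i (ldelta phi) l = ldelta (sd_iter n i phi) l.
Proof.
elim: i phi => //= i IH phi sl.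
by rewrite -IH //; apply: eq_sd_iter => // m sm; exact: sd_ldelta.
Qed.

(** Since [phi] is a cocycle, [sdh_ldelta] turns the term of index [i] into the [i]-fold subdivision
    of [phi - sd phi], and the sum telescopes. *)
Lemma ldelta_sum_sd N n phi l : size l = n.+1 ->
  (forall m, ldelta phi m = 0) ->
  ldelta (fun m => \sum_(i < N) sd_iter n i (sdh n phi) m) l =
  phi l - sd_iter n.+1 N phi l.
Proof.
move=> sl phi0; elim: N => [|N IH].
  by rewrite subrr ldelta_eq0 // => m; rewrite big_ord0.
rewrite [X in ldelta X](_ : _ = fun m => \sum_(i < N) sd_iter n i (sdh n phi) m +
  sd_iter n N (sdh n phi) m); last by apply/funext => m; rewrite big_ord_recr.
rewrite ldeltaD IH -sd_iter_ldelta // [sd_iter n.+1 N.+1 _ _]/=.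
rewrite (@eq_sd_iter _ _ (ldelta (sdh n phi))
  (fun m => phi m - sd n.+1 phi m)) //.
  by rewrite sd_iterB; ring.
by move=> m sm; rewrite -sdh_ldelta // sdh_eq0 ?add0r.
Qed.

(** These are the simplices of the barycentric subdivision of [l]: lists of barycentres of a flag of
    faces, from [l] itself down to a vertex. *)
Inductive sd_term : seq P -> seq P -> Prop :=
| SdTermNil : sd_term [::] [::]
| SdTermCons l j m : (j < size l)%N -> sd_term (rem_nth j l) m ->
    sd_term l (bary l :: m).

Lemma sd_eq0 n phi l : size l = n -> (forall m, sd_term l m -> phi m = 0) ->
  sd n phi l = 0.
Proof.
elim: n phi l => [|n IH] phi l sl phi0.
  by apply: phi0; rewrite (size0nil sl); exact: SdTermNil.
rewrite [sd _ _ _]/= ldeltaE big1 // => j _; rewrite IH ?mulr0 //.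
  by rewrite size_rem_nth ?sl.
by move=> m lm; apply/phi0/SdTermCons/lm.
Qed.

End Subdivision.

(** * Naturality of subdivision under maps that preserve barycentres *)

Section Naturality.
Variables (P Q : Type) (b : seq P -> P) (b' : seq Q -> Q) (f : P -> Q).
Hypothesis fb : forall l, (0 < size l)%N -> f (b l) = b' (map f l).

Lemma sd_map n phi l : size l = n ->
  sd b' n phi (map f l) = sd b n (phi \o map f) l.
Proof.
elim: n phi l => //= n IH phi l sl.
rewrite ldelta_map -fb ?sl //; apply: eq_ldelta sl _ => m sm.
by rewrite /= IH.
Qed.

Lemma sdh_map n phi l : size l = n ->
  sdh b' n phi (map f l) = sdh b n (phi \o map f) l.
Proof.
elim: n phi l => //= n IH phi l sl.
rewrite -fb ?sl //; congr (_ - _).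
by rewrite ldelta_map; apply: eq_ldelta sl _ => m sm; rewrite /= IH.
Qed.

Lemma sd_iter_map n i phi l : size l = n ->
  sd_iter b' n i phi (map f l) = sd_iter b n i (phi \o map f) l.
Proof.
elim: i phi => //= i IH phi sl.
by rewrite IH //; apply: eq_sd_iter => // m sm; rewrite -sd_map.
Qed.

End Naturality.

Section Prism.
Variable P : Type.
Implicit Types (phi : seq (P * bool) -> K) (l : seq P).

(** The booleans [false] and [true] mark the bottom and the top of the prism. *)
Definition level (i : bool) l : seq (P * bool) := map (fun a => (a, i)) l.

Fixpoint prism phi l : K :=
  if l is a :: l' then
    phi ((a, false) :: (a, true) :: level true l')
      - prism (fun m => phi ((a, false) :: m)) l'
  else 0.

Lemma prismB phi psi l :
  prism (fun m => phi m - psi m) l = prism phi l - prism psi l.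
Proof.
elim: l phi psi => [|a l IH] phi psi /=; first by rewrite subrr.
by rewrite IH; ring.
Qed.

(* The dual of [d P + P d = i_1 - i_0]. *)
Lemma prism_ldelta phi l :
  prism (ldelta phi) l + ldelta (prism phi) l =
  phi (level true l) - phi (level false l).
Proof.
elim: l phi => [|a l IH] phi /=; first by rewrite subrr addr0.
set psi := fun m => phi ((a, false) :: m).
rewrite [X in _ - X + _](_ : _ = prism phi l - prism (ldelta psi) l); last first.
  by rewrite -prismB.
rewrite ldeltaB; have -> : prism (ldelta psi) l =
    psi (level true l) - psi (level false l) - ldelta (prism psi) l
    by rewrite -IH; ring.
rewrite /level ldelta_map /psi /comp /=; ring.
Qed.

End Prism.

Lemma prism_map (P Q : Type) (f : P -> Q) (phi : seq (Q * bool) -> K)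
    (l : seq P) :
  prism phi (map f l) = prism (phi \o map (fun a => (f a.1, a.2))) l.
Proof.
elim: l phi => //= a l IH phi; rewrite IH; congr (phi _ - _).
by rewrite /level -!map_comp.
Qed.

Section Cup.
Variable P : Type.
Implicit Types (phi psi : seq P -> K) (l : seq P).

Definition lcup p phi psi : seq P -> K :=
  fun l => phi (take p.+1 l) * psi (drop p l).

(** The Leibniz rule, by induction on [p]: for positive [p] the first point lies in the front face
    only, so it can be fixed inside [phi]. *)
Lemma ldelta_lcup p phi psi l : (p.+1 < size l)%N ->
  ldelta (lcup p phi psi) l =
  lcup p.+1 (ldelta phi) psi l + (-1) ^+ p * lcup p phi (ldelta psi) l.
Proof.
rewrite /lcup; elim: p phi l => [|p IH] phi [|a [|b l]] // pl.
  rewrite expr0 mul1r /= !ldeltaZ !take0 /=; ring.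
have := IH (fun m => phi (a :: m)) (b :: l) pl.
rewrite /= exprS mulN1r => ->; ring.
Qed.

End Cup.

End ListCochains.

(** * Affine singular simplices *)

Section RowContinuity.
Variables (R : realType) (T : topologicalType).

Lemma row_continuous n (f : T -> 'rV[R]_n) :
  (forall j, continuous (fun t => f t ord0 j)) -> continuous f.
Proof.
move=> fc t A [P Pn sPA].
have near_P : nbhs t [set u | forall k j, P k j (f u k j)].
  apply: (@filter_forall _ _ (fun k u => forall j, P k j (f u k j))) => k.
  apply: (@filter_forall _ _ (fun j u => P k j (f u k j))) => j.
  by have := fc j t (P k j); rewrite (ord1 k); apply; exact: Pn.
by move: near_P; apply: (@filterS _ (nbhs t)) => u Pu; apply: sPA.
Qed.

Lemma subtype_continuous (X : topologicalType) (A : set X) (f : T -> A) :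
  continuous (\val \o f) -> continuous f.
Proof.
move=> /continuousP fc; apply/continuousP => B [C oC <-].
exact: (fc C oC).
Qed.

End RowContinuity.

Section Affine.
Variable R : realType.

Lemma vertex_subproof n (i : 'I_n.+1) :
  (delta_mx ord0 i : 'rV[R]_n.+1) \in std_simplex R n.
Proof.
rewrite inE; split=> [j|]; first by rewrite mxE ler0n.
rewrite (bigD1 i) //= big1 => [|j /negPf ij]; last by rewrite mxE ij andbF.
by rewrite mxE !eqxx addr0.
Qed.

Definition vertex n (i : 'I_n.+1) : std_simplex R n :=
  exist _ (delta_mx ord0 i) (vertex_subproof i).

Notation coord t j := ((\val t : 'rV[R]__) ord0 j).

Lemma coord_ge0 n (t : std_simplex R n) j : 0 <= coord t j.
Proof. by case: t => t /=; rewrite inE => -[]. Qed.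

Lemma coord_sum n (t : std_simplex R n) : \sum_j coord t j = 1.
Proof. by case: t => t /=; rewrite inE => -[]. Qed.

Lemma simplexP n (t u : std_simplex R n) :
  (forall j, coord t j = coord u j) -> t = u.
Proof. by move=> tu; apply/val_inj/rowP. Qed.

Section Aff.
Variables (k n : nat) (l : seq (std_simplex R n)).

(** Positions beyond the end of [l] are filled with the vertex 0, so the map is defined for lists of
    any length. *)
Definition aff_row (t : std_simplex R k) : 'rV[R]_n.+1 :=
  \row_j \sum_i coord t i * coord (nth (vertex ord0) l i) j.

Lemma aff_subproof t : aff_row t \in std_simplex R n.
Proof.
rewrite inE; split=> [j|].
  by rewrite mxE sumr_ge0 // => i _; rewrite mulr_ge0 ?coord_ge0.
under eq_bigr do rewrite mxE.
rewrite exchange_big -[RHS](coord_sum t); apply: eq_bigr => i _.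
by rewrite -mulr_sumr coord_sum mulr1.
Qed.

Definition aff (t : std_simplex R k) : std_simplex R n :=
  exist _ (aff_row t) (aff_subproof t).

Lemma affE t j :
  coord (aff t) j = \sum_i coord t i * coord (nth (vertex ord0) l i) j.
Proof. by rewrite mxE. Qed.

Lemma coord_cont m (j : 'I_m.+1) :
  continuous (fun t : std_simplex R m => coord t j).
Proof.
move=> t.
apply: (@continuous_comp _ _ _ _ (fun u : 'rV[R]_m.+1 => u ord0 j)).
  exact: initial_continuous.
exact: coord_continuous.
Qed.

Lemma lincomb_continuous (c : 'I_k.+1 -> R) :
  continuous (fun t : std_simplex R k => \sum_i coord t i * c i).
Proof.
move=> t; apply: (@cvg_big _ _ _ _ _ _ _ (nbhs t)) => [|i _].
  exact: add_continuous.
by apply: cvgMl; exact: coord_cont.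
Qed.

Lemma aff_continuous : continuous aff.
Proof.
apply/subtype_continuous/row_continuous => j.
under eq_fun do rewrite /= mxE.
exact: lincomb_continuous.
Qed.

HB.instance Definition _ := isContinuous.Build _ _ aff aff_continuous.

End Aff.

Lemma aff_aff k m n (l : seq (std_simplex R n)) (l' : seq (std_simplex R m)) t :
  size l' = k.+1 -> aff l (@aff k m l' t) = aff (map (@aff m n l) l') t.
Proof.
move=> sl; apply/simplexP => j; rewrite !affE.
under eq_bigr do rewrite affE mulr_suml.
rewrite exchange_big; apply: eq_bigr => i _.
rewrite (nth_map (vertex ord0)) ?sl // affE mulr_sumr.
by apply: eq_bigr => i' _; rewrite mulrA.
Qed.

Lemma vertex_mapE m n (a : 'I_m.+1 -> 'I_n.+1) (l : seq (std_simplex R n)) t :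
  (forall i : 'I_m.+1, nth (vertex ord0) l i = vertex (a i)) ->
  vertex_map a t = aff l t.
Proof.
move=> la; apply/simplexP => j; rewrite affE mxE big_mkcond /=.
apply: eq_bigr => i _; rewrite la mxE eqxx /= eq_sym.
by case: eqP => _; rewrite ?mulr1 ?mulr0.
Qed.

Definition verts n : seq (std_simplex R n) := map (@vertex n) (enum 'I_n.+1).

Lemma size_verts n : size (verts n) = n.+1.
Proof. by rewrite size_map size_enum_ord. Qed.

Lemma nth_verts n (i : 'I_n.+1) : nth (vertex ord0) (verts n) i = vertex i.
Proof.
rewrite (nth_map ord0) ?size_enum_ord //; congr vertex.
by apply/val_inj; rewrite /= nth_enum_ord.
Qed.

Lemma aff_verts n t : aff (verts n) t = t.
Proof.
apply/simplexP => j; rewrite affE (bigD1 j) //= big1 => [|i ij].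
  by rewrite nth_verts mxE !eqxx mulr1 addr0.
by rewrite nth_verts mxE [j == i]eq_sym (negPf ij) andbF mulr0.
Qed.

Lemma aff_vertex k n (l : seq (std_simplex R n)) (i : 'I_k.+1) :
  aff l (vertex i) = nth (vertex ord0) l i.
Proof.
apply/simplexP => j; rewrite affE (bigD1 i) //= big1 => [|i' ij].
  by rewrite mxE !eqxx mul1r addr0.
by rewrite mxE (negPf ij) andbF mul0r.
Qed.

Lemma map_aff_verts n k (l : seq (std_simplex R n)) : size l = k.+1 ->
  map (@aff k n l) (verts k) = l.
Proof.
move=> sl; apply: (@eq_from_nth _ (vertex ord0)) => [|i].
  by rewrite size_map size_verts sl.
rewrite size_map size_verts => ik; rewrite (nth_map (vertex ord0)) ?size_verts //.
by rewrite (nth_verts (Ordinal ik)) aff_vertex.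
Qed.

Lemma unif_subproof n : (const_mx (n.+1%:R^-1) : 'rV[R]_n.+1) \in std_simplex R n.
Proof.
rewrite inE; split=> [j|]; first by rewrite mxE invr_ge0 ler0n.
under eq_bigr do rewrite mxE.
by rewrite sumr_const card_ord -[LHS]mulr_natl mulfV // pnatr_eq0.
Qed.

Definition unif n : std_simplex R n := exist _ (const_mx _) (unif_subproof n).

Definition bary n (l : seq (std_simplex R n)) := aff l (unif (size l).-1).

Lemma aff_bary k n (l : seq (std_simplex R n)) (l' : seq (std_simplex R k)) :
  (0 < size l')%N -> aff l (bary l') = bary (map (@aff k n l) l').
Proof.
by move=> sl; rewrite /bary size_map aff_aff // prednK.
Qed.

Lemma nth_rem_nth (P : Type) (x0 : P) j (l : seq P) i : (j <= size l)%N ->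
  nth x0 (rem_nth j l) i = nth x0 l (bump j i).
Proof.
move=> jl.
rewrite /rem_nth nth_cat size_take_min (minn_idPl jl) /bump [(j <= i)%N]leqNgt.
case: ltnP => ij /=; first by rewrite nth_take.
by rewrite nth_drop; congr nth; rewrite add1n addSn subnKC.
Qed.

End Affine.

Notation coord t j := ((\val t : 'rV[_]__) ord0 j).

(** * Singular cochains as functions on lists of points *)

Section Pull.
Variables (R : realType) (K : comPzRingType) (Y : topologicalType).

(** The value 0 on lists of the wrong length makes [pull_ldelta] hold for every list, so that it can
    be used as an equality of functions. *)
Definition pull (P : Type) k (c : cochain R K Y k) (F : seq P -> singular R Y k)
    (l : seq P) : K :=
  if size l == k.+1 then c (F l) else 0.

Lemma pull_ldelta (P : Type) k (c : cochain R K Y k) (F : seq P -> singular R Y k)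
    (F' : seq P -> singular R Y k.+1) l :
  (forall (j : 'I_k.+2) l, size l = k.+2 ->
     singular_map (lift j) (F' l) = F (rem_nth j l)) ->
  pull (coboundary c) F' l = ldelta (pull c F) l.
Proof.
move=> FF; rewrite ldeltaE /pull; case: eqP => sl; last first.
  rewrite big1 // => j _; rewrite size_rem_nth //.
  case: eqP => [sl'|_]; last by rewrite mulr0.
  by case: sl; rewrite -sl' prednK // (leq_ltn_trans _ (ltn_ord j)).
rewrite /coboundary sl; apply: eq_bigr => j _.
by rewrite size_rem_nth sl // eqxx FF.
Qed.

Definition sing n (s : singular R Y n) k (l : seq (std_simplex R n)) :
  singular R Y k := s \o @aff R k n l.

Lemma singular_mapE n (s : singular R Y n) k (a : 'I_k.+1 -> 'I_n.+1) l :
  (forall i : 'I_k.+1, nth (vertex R ord0) l i = vertex R (a i)) ->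
  singular_map a s = sing s k l.
Proof.
move=> la; apply/continuousEP => t /=.
by rewrite (vertex_mapE t la).
Qed.

Lemma sing_verts n (s : singular R Y n) : sing s n (verts R n) = s.
Proof. by apply/continuousEP => t /=; rewrite aff_verts. Qed.

Lemma sing_sing n (s : singular R Y n) k l m l' : size l' = m.+1 ->
  sing (sing s k l) m l' = sing s m (map (@aff R k n l) l').
Proof. by move=> sl; apply/continuousEP => t /=; rewrite aff_aff. Qed.

Lemma singular_map_face n (s : singular R Y n.+1) (j : 'I_n.+2) :
  singular_map (lift j) s = sing s n (rem_nth j (verts R n.+1)).
Proof.
apply: singular_mapE => i.
by rewrite nth_rem_nth ?size_verts ?(ltnW (ltn_ord j)) // (nth_verts R (lift j i)).
Qed.

Lemma map_rem_nth (P Q : Type) (f : P -> Q) j l :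
  map f (rem_nth j l) = rem_nth j (map f l).
Proof. by rewrite /rem_nth map_cat map_take map_drop. Qed.

Lemma sing_face n (s : singular R Y n) k (j : 'I_k.+2) l : size l = k.+2 ->
  singular_map (lift j) (sing s k.+1 l) = sing s k (rem_nth j l).
Proof.
move=> sl; rewrite singular_map_face sing_sing ?size_rem_nth ?size_verts //.
by rewrite map_rem_nth map_aff_verts.
Qed.

Notation ev c s := (pull c (sing s _)).

Lemma ev_ldelta n k (c : cochain R K Y k) (s : singular R Y n) l :
  ev (coboundary c) s l = ldelta (ev c s) l.
Proof. by apply: pull_ldelta => j m sm; exact: sing_face. Qed.

Lemma ev_verts n (c : cochain R K Y n) s : ev c s (verts R n) = c s.
Proof. by rewrite /pull size_verts eqxx sing_verts. Qed.

Lemma coboundaryE n (c : cochain R K Y n) s :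
  coboundary c s = ldelta (ev c s) (verts R n.+1).
Proof. by rewrite -ev_ldelta ev_verts. Qed.

Lemma ev_sing n k (c : cochain R K Y k) (s : singular R Y n) m l l' :
  ev c (sing s m l) l' = ev c s (map (@aff R m n l) l').
Proof.
by rewrite /pull size_map; case: eqP => // sl; rewrite sing_sing.
Qed.

End Pull.
Notation ev c s := (pull c (sing s _)).

(** * Mesh of subdivisions *)

Section Mesh.
Variables (R : realType) (n : nat).
Notation pt := (std_simplex R n).
Notation "x .v" := (\val x : 'rV[R]_n.+1) (at level 2, format "x .v").
Implicit Types (l m : seq pt) (d r : R).

Definition mesh d l := {in l &, forall x y, `|x.v - y.v| <= d}.

Lemma aff_val k l t : (@aff R k n l t).v =
  \sum_i coord t i *: (nth (vertex R ord0) l i).v.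
Proof.
apply/rowP => j; rewrite [LHS]affE summxE.
by apply: eq_bigr => i _; rewrite mxE.
Qed.

Lemma aff_dist k l (t : std_simplex R k) (p : 'rV[R]_n.+1) :
  `|(aff l t).v - p| <= \sum_i coord t i * `|(nth (vertex R ord0) l i).v - p|.
Proof.
have -> : (aff l t).v - p =
    \sum_i coord t i *: ((nth (vertex R ord0) l i).v - p).
  rewrite -[p in LHS]scale1r -(coord_sum t) aff_val scaler_suml -sumrB.
  by apply: eq_bigr => i _; rewrite scalerBr.
apply: le_trans (ler_norm_sum _ _ _) _; apply: ler_sum => i _.
by rewrite normrZ ger0_norm // coord_ge0.
Qed.

Lemma aff_ball k l (t : std_simplex R k) p r : size l = k.+1 ->
  {in l, forall x, `|x.v - p| <= r} -> `|(aff l t).v - p| <= r.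
Proof.
move=> sl lr; apply: le_trans (aff_dist _ _ _) _.
rewrite -[r]mul1r -(coord_sum t) mulr_suml; apply: ler_sum => i _.
by rewrite ler_wpM2l ?coord_ge0 // lr // mem_nth // sl.
Qed.

Lemma bary_ball l p r : (0 < size l)%N ->
  {in l, forall x, `|x.v - p| <= r} -> `|(bary l).v - p| <= r.
Proof. by move=> sl; apply: aff_ball; rewrite prednK. Qed.

Lemma mem_rem_nth (T : eqType) j (s : seq T) : {subset rem_nth j s <= s}.
Proof.
by move=> x; rewrite mem_cat => /orP[/mem_take //|/mem_drop].
Qed.

Lemma sd_term_ball l m p r : sd_term (@bary R n) l m ->
  {in l, forall x, `|x.v - p| <= r} -> {in m, forall x, `|x.v - p| <= r}.
Proof.
elim=> {l m}[|l j m jl _ IH lr x]; first by [].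
rewrite inE => /predU1P[->|].
  by apply: bary_ball => //; apply: leq_ltn_trans jl.
by apply: IH => y /mem_rem_nth; exact: lr.
Qed.

(** In the average that bounds the distance, the term of [x] itself is 0; each of the other
    [(size l).-1] terms is at most [d], with weight the inverse of [size l]. *)
Lemma bary_mesh l d : mesh d l ->
  {in l, forall x, `|x.v - (bary l).v| <= (size l).-1%:R / (size l)%:R * d}.
Proof.
move=> ld x xl; have sl : (0 < size l)%N by case: (l) xl.
rewrite distrC -[X in _ / X%:R](prednK sl).
apply: le_trans (aff_dist _ _ _) _.
have ix : (index x l < (size l).-1.+1)%N by rewrite prednK // index_mem.
rewrite (bigD1 (Ordinal ix)) //= nth_index // subrr normr0 mulr0 add0r.
apply: (@le_trans _ _ (\sum_(i < (size l).-1.+1 | i != Ordinal ix)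
   (size l).-1.+1%:R^-1 * d)).
  apply: ler_sum => i _; rewrite mxE ler_wpM2l ?invr_ge0 //.
  by apply: ld => //; rewrite mem_nth // -[ltnRHS](prednK sl).
by rewrite sumr_const cardC1 card_ord -[X in X <= _]mulr_natl /= mulrA.
Qed.

(** The head of [m] is the barycentre of [l] and its tail stays in the convex hull of [l], so
    [bary_mesh] bounds the distances from the head. Distances within the tail are bounded by
    induction on a face of [l]. *)
Lemma sd_term_mesh N l m d : 0 <= d -> (size l <= N.+1)%N ->
  sd_term (@bary R n) l m -> mesh d l -> mesh (N%:R / N.+1%:R * d) m.
Proof.
move=> d0 + lm; elim: lm => {l m}[|l j m jl lm IH sl ld]; first by [].
have c0 : 0 <= N%:R / N.+1%:R * d by rewrite !mulr_ge0.
have sl0 : (0 < size l)%N by apply: leq_ltn_trans jl.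
have bl : {in l, forall x, `|x.v - (bary l).v| <= N%:R / N.+1%:R * d}.
  (* The factor in [bary_mesh] grows with [size l], which is at most [N.+1]. *)
  move=> x xl; apply: le_trans (bary_mesh ld xl) _; apply: ler_wpM2r => //.
  rewrite ler_pdivlMr ?ltr0n // mulrAC ler_pdivrMr ?ltr0n // -!natrM ler_nat.
  case: (size l) sl sl0 => // p; rewrite ltnS /= => pN _.
  by rewrite !mulnS mulnC leq_add2r.
have bm : {in m, forall x, `|x.v - (bary l).v| <= N%:R / N.+1%:R * d}.
  by apply: sd_term_ball lm _ => x /mem_rem_nth; exact: bl.
move=> x y; rewrite !inE => /predU1P[->|xm] /predU1P[->|ym].
- by rewrite subrr normr0.
- by rewrite distrC bm.
- by rewrite bm.
- apply: IH => //; last by move=> u v /mem_rem_nth ul /mem_rem_nth vl; apply: ld.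
  by rewrite size_rem_nth // (leq_trans (leq_pred _)).
Qed.

(** Dually, [sd_iter] evaluates [phi] on the simplices of the [i]-fold subdivision of [l], and each
    subdivision shrinks the mesh by the factor of [sd_term_mesh]. *)
Lemma sd_iter_small (K : comPzRingType) N i (phi : seq pt -> K) l d : 0 <= d ->
  size l = N.+1 -> mesh d l ->
  (forall m, size m = N.+1 -> mesh ((N%:R / N.+1%:R) ^+ i * d) m -> phi m = 0) ->
  sd_iter (@bary R n) N.+1 i phi l = 0.
Proof.
move=> d0 sl ld; elim: i phi => [|i IH] phi phi0 /=.
  by apply: phi0 => //; rewrite expr0 mul1r.
apply: IH => m sm md.
suff H m' : sd_term (@bary R n) m m' -> phi m' = 0 by exact: sd_eq0 sm H.
move=> mm'; apply: phi0.
  rewrite -sm; elim: mm' {sm md} => // m1 j m2 jm _ /= ->.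
  by rewrite size_rem_nth // prednK // (leq_ltn_trans _ jm).
rewrite exprS -mulrA; apply: sd_term_mesh mm' md => //; last by rewrite sm.
by rewrite mulr_ge0 // exprn_ge0 // divr_ge0.
Qed.

Lemma mesh_exists l : exists2 d, 0 <= d & mesh d l.
Proof.
exists (\sum_(x <- l) `|x.v| *+ 2).
  by rewrite sumr_ge0 // => *; rewrite mulrn_wge0.
have H x : x \in l -> `|x.v| <= \sum_(x <- l) `|x.v|.
  move=> xl; rewrite (big_rem x) //= lerDl sumr_ge0 // => *.
move=> x y xl yl; rewrite sumrMnl mulr2n (le_trans (ler_normB _ _)) //.
by rewrite lerD // H.
Qed.

Lemma mesh_small N d e : 0 < e ->
  exists i0, forall i, (i0 <= i)%N -> (N%:R / N.+1%:R) ^+ i * d < e.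
Proof.
move=> e0; have c1 : `|N%:R / N.+1%:R : R| < 1.
  by rewrite ger0_norm ?divr_ge0 // ltr_pdivrMr // mul1r ltr_nat.
have := cvg_geometric d c1 => /cvgr0Pnorm_lt /(_ e e0)[i0 _ H].
exists i0 => i ii0; have := H i ii0; rewrite /geometric /= mulrC.
exact/le_lt_trans/ler_norm.
Qed.

End Mesh.

(** * Lebesgue numbers on the standard simplex *)

Section Lebesgue.
Variables (R : realType) (n : nat).
Notation "x .v" := (\val x : 'rV[R]_n.+1) (at level 2, format "x .v").

Lemma std_simplex_compact : compact (std_simplex R n).
Proof.
have cbox : compact
    [set v : 'rV[R]_n.+1 | forall i, (`[0, 1]%classic : set R) (v ord0 i)].
  apply: (@rV_compact R^o _ (fun=> `[0, 1]%classic)).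
  by move=> _; apply: segment_compact.
apply: (subclosed_compact _ cbox) => [|v [v0 v1] i]; last first.
  rewrite /= in_itv /= v0 -v1 (bigD1 i) //= lerDl sumr_ge0 // => j _; exact: v0.
have -> : std_simplex R n =
    (\bigcap_(j in [set: 'I_n.+1])
      ((fun v : 'rV[R]_n.+1 => v ord0 j) @^-1` [set x | 0 <= x])) `&`
    ((fun v : 'rV[R]_n.+1 => \sum_j v ord0 j) @^-1` [set 1]).
  apply/seteqP; split=> v /= [v0 v1]; split=> // j; first by move=> _; exact: v0.
  exact: v0.
apply: closedI.
  apply: closed_bigI => j _; apply: closed_comp; last exact: closed_ge.
  by move=> x _; exact: coord_continuous.
apply: closed_comp; last exact: closed_eq.
move=> x _; apply: (@cvg_big _ _ _ _ _ _ _ (nbhs x)) => [|i _].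
  exact: add_continuous.
exact: coord_continuous.
Qed.

Lemma open_subtype (A : set (std_simplex R n)) : open A ->
  exists2 C : set 'rV[R]_n.+1, open C & forall x, A x <-> C x.v.
Proof. by move=> [C oC CA]; exists C => // x; rewrite -CA. Qed.

(** Compactness enters as the near-covering property: radii that work near each point yield one
    radius for the whole simplex. *)
Lemma lebesgue (V W : set (std_simplex R n)) : open V -> open W ->
  (forall x : std_simplex R n, V x \/ W x) ->
  exists2 e, 0 < e & forall x : std_simplex R n,
    (forall y : std_simplex R n, `|x.v - y.v| < e -> V y) \/
    (forall y : std_simplex R n, `|x.v - y.v| < e -> W y).
Proof.
move=> /open_subtype[A oA VA] /open_subtype[B oB WB] VW.
pose P e (x : 'rV[R]_n.+1) := ball x e `<=` A \/ ball x e `<=` B.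
have /compact_near_coveringP/(_ R (0^'+) P _) near_cover := std_simplex_compact.
have H : \forall e \near 0^'+, std_simplex R n `<=` P e.
  apply: near_cover => x Kx.
  have near_ball (C : set 'rV[R]_n.+1) : open C -> C x ->
      \forall x' \near x & e \near 0^'+, ball x' e `<=` C.
    move=> oC Cx; have /nbhs_ballP[r /= r0 rC] : nbhs x C by exact: open_nbhs_nbhs.
    (* By the triangle inequality, half the radius serves every centre near [x]. *)
    have r20 : 0 < r / 2 by rewrite divr_gt0.
    near=> x' e.
    have er : e <= r / 2 by near: e; exact: nbhs_right_le.
    have xx' : ball x (r / 2) x' by near: x'; exact: nbhsx_ballx.
    move=> y x'y; apply: rC.
    rewrite [r]splitr; apply: (@ball_triangle _ _ x') => //.
    exact: le_ball er _ x'y.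
  have Kx' : x \in std_simplex R n by rewrite inE.
  have [Vx|Wx] := VW (exist _ x Kx').
    have := near_ball A oA (iffLR (VA _) Vx).
    by apply: filterS => -[x' e] /= ?; left.
  have := near_ball B oB (iffLR (WB _) Wx).
  by apply: filterS => -[x' e] /= ?; right.
have [e [e0 He]] : exists e, 0 < e /\ std_simplex R n `<=` P e.
  have := @filter_ex _ (0^'+ : set_system R) _ _ (filterI H (nbhs_right_gt 0)).
  by move=> [e []]; exists e.
exists e => // x; have Kx : std_simplex R n x.v by case: x => x /= /set_mem.
have [xA|xB] := He _ Kx; [left|right] => y xy.
  by apply/VA/xA; rewrite mx_norm_ball.
by apply/WB/xB; rewrite mx_norm_ball.
Unshelve. all: by end_near. Qed.

End Lebesgue.

(** * Small simplices *)

Section SmallSimplices.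
Variables (R : realType) (K : comPzRingType) (Y : topologicalType).

Definition carried n (A : set Y) (s : singular R Y n) := forall t, A (s t).

(** Relative notions restrict the simplices and not the cochains: a cochain is defined on all of
    [Y], and conditions bear on the simplices carried by [A]. *)
Definition cocycle_on (A : set Y) n (z : cochain R K Y n) :=
  forall s, carried A s -> coboundary z s = 0.

Lemma carried_comp A n (s : singular R Y n) m (s' : singular R Y m) :
  (forall t, exists u, s' t = s u) -> carried A s -> carried A s'.
Proof. by move=> ss' sA t; have [u ->] := ss' t. Qed.

Lemma carried_sing A n (s : singular R Y n) m l :
  carried A s -> carried A (sing s m l).
Proof. by apply: carried_comp => t; exists (aff l t). Qed.

Lemma carried_face A n (s : singular R Y n) m (a : 'I_m.+1 -> 'I_n.+1) :
  carried A s -> carried A (singular_map a s).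
Proof. by apply: carried_comp => t; exists (vertex_map a t). Qed.

Lemma carried_sub A B n (s : singular R Y n) :
  A `<=` B -> carried A s -> carried B s.
Proof. by move=> AB As t; apply/AB/As. Qed.

Lemma singular_continuous n (s : singular R Y n) : continuous s.
Proof. exact: cts_fun. Qed.

Section Small.
Variables V W : set Y.
Hypotheses (oV : open V) (oW : open W).

Lemma small_lebesgue n (s : singular R Y n) : carried (V `|` W) s ->
  exists2 e, 0 < e & forall k (l : seq (std_simplex R n)) d,
    size l = k.+1 -> mesh d l -> d < e ->
    carried V (sing s k l) \/ carried W (sing s k l).
Proof.
move=> sVW; have oV' := open_comp (fun x _ => @singular_continuous n s x) oV.
have oW' := open_comp (fun x _ => @singular_continuous n s x) oW.
have [e e0 He] := lebesgue oV' oW' sVW.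
exists e => // k l d sl ld de.
have x0l : nth (vertex R ord0) l 0 \in l by rewrite mem_nth ?sl.
set x0 := nth _ _ _ in x0l.
have near_x0 t : `|\val x0 - \val (@aff R k n l t)| < e.
  apply: le_lt_trans de; rewrite distrC; apply: aff_ball => // y yl.
  exact: ld.
by have [H|H] := He x0; [left|right] => t; apply/H/near_x0.
Qed.

Lemma ev_eq0 k (z : cochain R K Y k) n (s : singular R Y n) A l :
  (forall s', carried A s' -> z s' = 0) -> carried A s -> ev z s l = 0.
Proof.
move=> z0 sA; rewrite /pull; case: eqP => // sl.
by apply: z0; apply: carried_sing.
Qed.


Section Cochain.
Variables (k : nat) (z : cochain R K Y k.+1).
Hypothesis zV : forall s, carried V s -> z s = 0.
Hypothesis zW : forall s, carried W s -> z s = 0.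

Lemma ev_small_eq0 n (s : singular R Y n) l :
  carried V s \/ carried W s -> ev z s l = 0.
Proof. by move=> [] sA; [exact: ev_eq0 zV sA|exact: ev_eq0 zW sA]. Qed.

Definition subdivision_term n (s : singular R Y n) i l :=
  sd_iter (@bary R n) k.+1 i (sdh (@bary R n) k.+1 (ev z s)) l.

Lemma subdivision_term_sing n (s : singular R Y n) i l m : size l = k.+1 ->
  size m = k.+1 ->
  subdivision_term (sing s k m) i l = subdivision_term s i (map (@aff R k n m) l).
Proof.
move=> sl sm; rewrite /subdivision_term.
rewrite (@sd_iter_map _ _ _ (@bary R k) (@bary R n) (aff m)) //; last first.
  by move=> l'; exact: aff_bary.
apply: eq_sd_iter => // l' sl'.
rewrite -[RHS]/(sdh _ k.+1 (ev z s) (map (@aff R k n m) l')).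
rewrite (@sdh_map _ _ _ (@bary R k) (@bary R n) (aff m)) //; last first.
  by move=> l'' sl''; exact: aff_bary.
congr (sdh _ _ _ l'); apply/funext => l'' /=.
by rewrite ev_sing.
Qed.

(** The subdivision homotopy of a simplex involves only simplices inside it. Naturality shows this
    by moving the computation to [sing s k m], which lies in [V] or in [W]. *)
Lemma sdh_small_eq0 n (s : singular R Y n) m : size m = k.+1 ->
  carried V (sing s k m) \/ carried W (sing s k m) ->
  sdh (@bary R n) k.+1 (ev z s) m = 0.
Proof.
move=> sm small; rewrite -(map_aff_verts sm).
rewrite (@sdh_map _ _ _ (@bary R k) (@bary R n) (aff m)) ?size_verts //; last first.
  by move=> l' sl'; exact: aff_bary.
apply: sdh_eq0 => l /=; rewrite -ev_sing; exact: ev_small_eq0.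
Qed.

Lemma subdivision_term_eq0 n (s : singular R Y n) l : size l = k.+1 ->
  carried (V `|` W) s ->
  exists N, forall i, (N <= i)%N -> subdivision_term s i l = 0.
Proof.
move=> sl sVW; have [e e0 He] := small_lebesgue sVW.
have [d d0 ld] := mesh_exists l.
have [N HN] := mesh_small k d e0.
exists N => i Ni; apply: sd_iter_small d0 sl ld _ => m sm md.
by apply: sdh_small_eq0 => //; apply: He md (HN i Ni).
Qed.

Lemma sd_iter_ev_eq0 n (s : singular R Y n) l : size l = k.+2 ->
  carried (V `|` W) s ->
  exists N, forall i, (N <= i)%N -> sd_iter (@bary R n) k.+2 i (ev z s) l = 0.
Proof.
move=> sl sVW; have [e e0 He] := small_lebesgue sVW.
have [d d0 ld] := mesh_exists l.
have [N HN] := mesh_small k.+1 d e0.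
exists N => i Ni; apply: sd_iter_small d0 sl ld _ => m sm md.
rewrite /pull sm eqxx; have [H|H] := He k.+1 m _ sm md (HN i Ni).
  exact: zV.
exact: zW.
Qed.

(* Only finitely many terms of [\sum_i z (T (Sd^i s))] are nonzero, since [z]
   vanishes on simplices subordinate to the cover. *)
Lemma small_simplices : cocycle_on (V `|` W) z ->
  exists b : cochain R K Y k,
    forall s, carried (V `|` W) s -> z s = coboundary b s.
Proof.
move=> zc.
(* The number of subdivisions needed depends on the simplex, so the length of the sum defining [b]
   is chosen simplex by simplex. *)
have /choice[N HN] : forall s : singular R Y k, exists N, carried (V `|` W) s ->
    forall i, (N <= i)%N -> subdivision_term s i (verts R k) = 0.
  move=> s; have [sVW|] := pselect (carried (V `|` W) s); last by exists 0%N.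
  by have [N HN] := subdivision_term_eq0 (size_verts R k) sVW; exists N.
pose b s := \sum_(i < N s) subdivision_term s i (verts R k).
have bE s M : carried (V `|` W) s -> (N s <= M)%N ->
    b s = \sum_(i < M) subdivision_term s i (verts R k).
  move=> sVW NM; rewrite -!(big_mkord xpredT (fun i => subdivision_term s i _)).
  rewrite (@big_cat_nat _ _ _ (N s)) //=.
  rewrite [X in _ = _ + X]big_nat_cond [X in _ = _ + X]big1 ?addr0 ?big_mkord //.
  by move=> i; rewrite andbT => /andP[Ni _]; exact: HN.
exists b => s sVW.
have [N' HN'] := sd_iter_ev_eq0 (size_verts R k.+1) sVW.
(* Large enough for [s] and all its faces, so that all the sums can be taken over one range. *)
pose M := maxn N' (\max_(j < k.+2) N (singular_map (lift j) s)).
have -> : z s = ev z s (verts R k.+1)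
    - sd_iter (@bary R k.+1) k.+2 M (ev z s) (verts R k.+1).
  by rewrite HN' ?leq_maxl // subr0 ev_verts.
rewrite -ldelta_sum_sd ?size_verts //; last first.
  move=> m; rewrite -ev_ldelta; exact: ev_eq0 zc sVW.
rewrite ldeltaE size_verts; apply: eq_bigr => j _; congr (_ * _).
rewrite (bE _ M); last 2 first.
- exact: carried_face.
- by rewrite /M leq_max; apply/orP; right; rewrite (bigD1 j) //= leq_maxl.
apply: eq_bigr => i _; rewrite singular_map_face subdivision_term_sing.
- by rewrite map_aff_verts // size_rem_nth size_verts.
- exact: size_verts.
- by rewrite size_rem_nth size_verts.
Qed.

End Cochain.
End Small.
End SmallSimplices.

(** * Homotopy invariance *)

Section Homotopy.
Variables (R : realType) (K : comPzRingType) (X Y : topologicalType).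
Variable H : X * R -> Y.
Hypothesis Hc : {within [set: X] `*` `[0, 1], continuous H}.

Lemma within_comp_continuous (T : topologicalType) (G : T -> X * R) :
  continuous G -> (forall t, G t \in [set: X] `*` `[0, 1]) -> continuous (H \o G).
Proof.
move=> Gc GA t B HB.
have /subspace_continuousP/(_ (G t)) := Hc.
move=> /(_ (set_mem (GA t)) B HB) /= HB'.
have HG : \forall u \near t, ([set: X] `*` `[0, 1]) (G u) -> B (H (G u)).
  exact: Gc t _ HB'.
by apply: filterS HG => u; apply; exact/set_mem.
Qed.

Section Prism.
Variables (n : nat) (s : singular R X n).
Implicit Type l : seq (std_simplex R n * bool).

(** The heights 0 and 1 are represented by the vertices of a 1-simplex, so that [aff] interpolates
    them too; the coordinate [ord_max] is the height. *)
Definition height l : seq (std_simplex R 1) :=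
  [seq vertex R (if a.2 then ord_max else ord0) | a <- l].

Definition prism_pt k l (t : std_simplex R k) : X * R :=
  (s (aff (map fst l) t), coord (aff (height l) t) ord_max).

Lemma prism_pt_in k l t : @prism_pt k l t \in [set: X] `*` `[0, 1].
Proof.
rewrite inE; split=> //; rewrite /prism_pt; move: (aff (height l) t) => u.
rewrite /= in_itv /= coord_ge0 -(coord_sum u) (bigD1 ord_max) //= lerDl.
by rewrite sumr_ge0 // => j _; exact: coord_ge0.
Qed.

Lemma prism_pt_continuous k l : continuous (@prism_pt k l).
Proof.
move=> t; have c1 : {for t, continuous (fun u => s (@aff R k n (map fst l) u))}.
  apply: (@continuous_comp _ _ _ _ s); first exact: aff_continuous.
  exact: singular_continuous.
have c2 : {for t, continuous (fun u => coord (@aff R k 1 (height l) u) ord_max)}.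
  apply: (@continuous_comp _ _ _ _ (fun u : std_simplex R 1 => coord u ord_max)).
    exact: aff_continuous.
  exact: coord_cont.
exact: cvg_pair c1 c2.
Qed.

Definition prism_singular k l : singular R Y k :=
  mkcts (within_comp_continuous (@prism_pt_continuous k l) (@prism_pt_in k l)).

Lemma prism_singularE k l t : @prism_singular k l t = H (prism_pt l t).
Proof. by []. Qed.

Lemma aff_face m k (j : 'I_k.+2) (l : seq (std_simplex R m)) t :
  size l = k.+2 -> aff l (vertex_map (lift j) t) = aff (rem_nth j l) t.
Proof.
move=> sl; rewrite (@vertex_mapE _ _ _ _ (rem_nth j (verts R k.+1))); last first.
  move=> i.
  by rewrite nth_rem_nth ?size_verts ?(ltnW (ltn_ord j)) // (nth_verts R (lift j i)).
by rewrite aff_aff ?size_rem_nth ?size_verts // map_rem_nth map_aff_verts.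
Qed.

Lemma prism_singular_face k (j : 'I_k.+2) l : size l = k.+2 ->
  singular_map (lift j) (prism_singular k.+1 l) = prism_singular k (rem_nth j l).
Proof.
move=> sl; apply/continuousEP => t /=; rewrite !prism_singularE /prism_pt.
by rewrite !aff_face ?size_map // /height !map_rem_nth.
Qed.

End Prism.

Lemma prism_singular_sing n (s : singular R X n) m l0 k l : size l = k.+1 ->
  prism_singular (sing s m l0) k l =
  prism_singular s k (map (fun a => (aff l0 a.1, a.2)) l).
Proof.
move=> sl; apply/continuousEP => t; rewrite !prism_singularE /prism_pt /=.
by rewrite aff_aff ?size_map // /height -!map_comp.
Qed.

Variables f g : X -> Y.
Hypotheses (H0 : forall x, H (x, 0) = f x) (H1 : forall x, H (x, 1) = g x).

Lemma prism_singular_level b n (s : singular R X n) t :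
  prism_singular s n (level b (verts R n)) t = if b then g (s t) else f (s t).
Proof.
rewrite prism_singularE /prism_pt.
have -> : map fst (level b (verts R n)) = verts R n.
  by rewrite /level -map_comp; exact: map_id.
rewrite /height /level -map_comp aff_verts affE.
rewrite (eq_bigr (fun i => coord t i * b%:R)) => [|i _]; last first.
  rewrite (nth_map (vertex R ord0)) ?size_verts //= mxE.
  by case: b.
by rewrite -mulr_suml coord_sum mul1r; case: b.
Qed.

(** This is [prism_ldelta] for the pulled-back cochain, whose coboundary term vanishes because [z]
    is a cocycle. *)
Lemma prism_coboundary k (z : cochain R K Y k) (s : singular R X k)
    (sf sg : singular R Y k) :
  is_cocycle z -> (forall t, sf t = f (s t)) -> (forall t, sg t = g (s t)) ->
  z sg - z sf = ldelta (prism (pull z (prism_singular s k))) (verts R k).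
Proof.
move=> zc sfE sgE.
have := prism_ldelta (pull z (prism_singular s k)) (verts R k).
rewrite [X in prism X](_ : _ = fun=> 0); last first.
  apply/funext => l; rewrite -(@pull_ldelta _ _ _ _ _ _ _ (prism_singular s k.+1)).
    by rewrite /pull; case: eqP => // _; exact: zc.
  by move=> j l' sl; exact: prism_singular_face.
rewrite (_ : prism (fun=> 0) _ = 0); last first.
  by elim: (verts R k) => //= a l ->; rewrite subr0.
rewrite add0r => ->; rewrite /pull /level !size_map -!enumT size_enum_ord eqxx.
congr (z _ - z _); apply/continuousEP => t.
  by rewrite sgE -(prism_singular_level true).
by rewrite sfE -(prism_singular_level false).
Qed.

Lemma prism_face k (z : cochain R K Y k) n (s : singular R X n) m l :
  size l = m.+1 ->
  prism (pull z (prism_singular (sing s m l) k)) (verts R m) =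
  prism (pull z (prism_singular s k)) l.
Proof.
move=> sl; rewrite -[in RHS](map_aff_verts sl) prism_map; congr (prism _ _).
apply/funext => l' /=; rewrite /pull size_map; case: eqP => // sl'.
by rewrite prism_singular_sing.
Qed.

(** The simplices [sf] and [sg] are given through their values because [f] and [g] are plain
    functions, not bundled with their continuity. *)
Lemma homotopy_cochain k (z : cochain R K Y k.+1) : is_cocycle z ->
  exists b : cochain R K X k,
  forall (s : singular R X k.+1) (sf sg : singular R Y k.+1),
  (forall t, sf t = f (s t)) -> (forall t, sg t = g (s t)) ->
  z sg - z sf = coboundary b s.
Proof.
move=> zc; exists (fun s => prism (pull z (prism_singular s k.+1)) (verts R k)).
move=> s sf sg sfE sgE; rewrite (prism_coboundary zc sfE sgE).
rewrite ldeltaE size_verts; apply: eq_bigr => j _; congr (_ * _).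
by rewrite singular_map_face prism_face // size_rem_nth ?size_verts.
Qed.

Lemma homotopy_cochain0 (z : cochain R K Y 0) : is_cocycle z ->
  forall (s : singular R X 0) (sf sg : singular R Y 0),
  (forall t, sf t = f (s t)) -> (forall t, sg t = g (s t)) -> z sg = z sf.
Proof.
move=> zc s sf sg sfE sgE; apply/eqP; rewrite -subr_eq0.
rewrite (prism_coboundary zc sfE sgE) ldeltaE size_verts big1 // => j _.
(* The only face of a single vertex is the empty list, on which [prism] is 0. *)
rewrite [rem_nth _ _]size0nil ?mulr0 //.
by rewrite size_rem_nth ?size_verts.
Qed.

End Homotopy.

(** * Acyclicity of contractible subspaces *)

Section Contractible.
Variables (R : realType) (K : comPzRingType).

(* The augmented cochain complex: degree [n] of a cochain is shifted by one, and
   constants are adjoined in degree [0]. *)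
Definition acochain (Y : topologicalType) n :=
  if n is m.+1 then cochain R K Y m else K.

Definition adelta (Y : topologicalType) n : acochain Y n -> cochain R K Y n :=
  match n with 0 => fun c _ => c | m.+1 => @coboundary R K Y m end.

Definition cob_on (Y : topologicalType) (A : set Y) n (z : cochain R K Y n) :=
  exists b : acochain Y n, forall s, carried A s -> z s = adelta b s.

Lemma sum_sign n : \sum_(j < n) (-1) ^+ j = (odd n)%:R :> K.
Proof.
elim: n => [|n IH]; first by rewrite big_ord0.
rewrite big_ord_recr IH /= -signr_odd.
by case: (odd n); rewrite ?expr1 ?subrr ?expr0 ?add0r.
Qed.

Definition const_singular (Y : topologicalType) n (y : Y) : singular R Y n :=
  mkcts (@cst_continuous (std_simplex R n) Y y).

Lemma singular_map_const (Y : topologicalType) (y : Y) m n a :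
  singular_map a (const_singular n y) = const_singular m y.
Proof. exact/continuousEP. Qed.

(** The contraction makes [z] cohomologous to the constant cochain [c], its value on a constant
    simplex; it remains to deal with constants. *)
Lemma contractible_acyclic (Y : topologicalType) n (z : cochain R K Y n) :
  contractible R Y -> is_cocycle z ->
  exists b : acochain Y n, forall s, z s = adelta b s.
Proof.
move=> [y [H [Hc H0 H1]]] zc; set c := z (const_singular n y).
have sE (s : singular R Y n) (t : std_simplex R n) : s t = id (s t) by [].
have cE (s : singular R Y n) (t : std_simplex R n) :
  const_singular n y t = (fun=> y) (s t) by [].
(* In odd degree, the cocycle condition on a constant simplex gives [c = 0]. In even positive
   degree, the constant [c] is itself the coboundary of a constant cochain. *)
have := zc (const_singular n.+1 y); rewrite /coboundary.
under eq_bigr do rewrite singular_map_const.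
rewrite -mulr_suml sum_sign -/c /=.
case: n z zc @c sE cE => [|n] z zc c sE cE /= c0.
  exists c => s.
  by rewrite /c (homotopy_cochain0 (f := id) Hc H0 H1 zc (sE s) (cE s)).
have [b bE] := homotopy_cochain (f := id) Hc H0 H1 zc.
exists (fun s => c - b s) => s.
have -> : coboundary (fun s => c - b s) s =
    \sum_(j < n.+2) (-1) ^+ j * c - coboundary b s.
  by rewrite /coboundary -sumrB; apply: eq_bigr => j _; rewrite mulrBr.
rewrite -(bE _ _ _ (sE s) (cE s)) -/c -mulr_suml sum_sign /=.
case: (odd n) c0 => /=; rewrite ?mul0r ?mul1r => c0.
  by rewrite opprB addrCA subrr addr0.
by rewrite c0 !sub0r opprK.
Qed.

Section Subspace.
Variables (Y : topologicalType) (A : set Y).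

Lemma val_continuous : continuous (\val : A -> Y).
Proof. exact: initial_continuous. Qed.

Definition incl n (s : singular R A n) : singular R Y n :=
  mkcts (fun t => continuous_comp (@singular_continuous _ _ _ s t)
    (@val_continuous (s t))).

Lemma lift_continuous n (s : singular R Y n) (sA : carried A s) :
  continuous (fun t => exist _ (s t) (mem_set (sA t)) : A).
Proof. by apply: subtype_continuous; exact: singular_continuous. Qed.

Definition lift_singular n (s : singular R Y n) (sA : carried A s) :
  singular R A n := mkcts (@lift_continuous _ s sA).

Lemma incl_lift n (s : singular R Y n) (sA : carried A s) :
  incl (lift_singular sA) = s.
Proof. exact/continuousEP. Qed.

Lemma incl_carried n (s : singular R A n) : carried A (incl s).
Proof. by move=> t; exact: set_valP. Qed.

Lemma incl_face m n (a : 'I_m.+1 -> 'I_n.+1) (s : singular R A n) :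
  singular_map a (incl s) = incl (singular_map a s).
Proof. exact/continuousEP. Qed.

Lemma contractible_cob_on n (z : cochain R K Y n) :
  contractible R A -> cocycle_on A z -> cob_on A z.
Proof.
move=> cA zc; have zc' : is_cocycle (fun s => z (incl s)).
  move=> s; rewrite -[RHS](zc (incl s)); last exact: incl_carried.
  by apply: eq_bigr => j _; rewrite incl_face.
have [b bE] := contractible_acyclic cA zc'.
case: n z zc zc' b bE => [|n] z zc zc' b bE.
  by exists b => s sA; rewrite -(incl_lift sA) bE.
(* The cochain found on the subspace is extended by 0 to the simplices that leave [A]. *)
exists (fun s =>
  if pselect (carried A s) is left sA then b (lift_singular sA) else 0).
move=> s sA; rewrite -[in LHS](incl_lift sA) bE.
apply: eq_bigr => j _; congr (_ * _).
case: pselect => [sA'|]; last by case; exact: carried_face.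
by congr b; apply/continuousEP => t; apply/val_inj.
Qed.

End Subspace.
End Contractible.

(** * Mayer-Vietoris and nerves *)

Section Vanishing.
Variables (R : realType) (K : comPzRingType) (Y : topologicalType).
Implicit Types A V W : set Y.

(* Reduced cohomology vanishes in degree [n - 1]; for [n = 0] this means that
   the set is nonempty. *)
Definition vanishes A n :=
  if n is m.+1 then
    forall z : cochain R K Y m, cocycle_on A z -> cob_on A z
  else A !=set0.

Lemma coboundaryB n (b c : cochain R K Y n) s :
  coboundary (fun s => b s - c s) s = coboundary b s - coboundary c s.
Proof.
by rewrite /coboundary -sumrB; apply: eq_bigr => j _; rewrite mulrBr.
Qed.

Lemma coboundaryD n (b c : cochain R K Y n) s :
  coboundary (fun s => b s + c s) s = coboundary b s + coboundary c s.
Proof.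
by rewrite /coboundary -big_split; apply: eq_bigr => j _; rewrite mulrDr.
Qed.

Lemma coboundary_coboundary n (b : cochain R K Y n) s :
  coboundary (coboundary b) s = 0.
Proof.
rewrite coboundaryE [ev _ _](_ : _ = ldelta (ev b s)) ?ldelta_ldelta //.
by apply/funext => l; rewrite ev_ldelta.
Qed.

Lemma coboundary_adelta n (b : acochain R K Y n) s : coboundary (adelta b) s = 0.
Proof.
case: n b s => [|n] b s; last exact: coboundary_coboundary.
by rewrite /coboundary -mulr_suml sum_sign mul0r.
Qed.

Lemma eq_coboundary n (b c : cochain R K Y n) (s : singular R Y n.+1) :
  (forall j : 'I_n.+2, b (singular_map (lift j) s) = c (singular_map (lift j) s)) ->
  coboundary b s = coboundary c s.
Proof. by move=> bc; apply: eq_bigr => j _; rewrite bc. Qed.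

Lemma eq_coboundary_on A n (b c : cochain R K Y n) (s : singular R Y n.+1) :
  (forall s : singular R Y n, carried A s -> b s = c s) -> carried A s ->
  coboundary b s = coboundary c s.
Proof.
move=> bc sA; apply: eq_coboundary => j; apply: bc.
exact: carried_face.
Qed.

Lemma vanishes_set0 n : vanishes set0 n.+1.
Proof.
move=> z _; have b : acochain R K Y n.
  by case: n {z} => [|n]; [exact: 0|move=> _; exact: 0].
by exists b => s s0; case: (s0 (vertex R ord0)).
Qed.

Lemma simplex0_eq (t u : std_simplex R 0) : t = u.
Proof.
apply/simplexP => j; rewrite [j]ord1.
by have := coord_sum t; have := coord_sum u; rewrite !big_ord1 => -> ->.
Qed.

(** Primitives [a] on [V] and [b] on [W] differ on the intersection by a cocycle, hence by a
    coboundary. Correcting [b] by it glues them to a cochain [e]; then [z] minus the coboundary of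
    [e] vanishes on small simplices, and [small_simplices] applies. *)
Lemma mayer_vietoris V W n : open V -> open W ->
  vanishes V n.+1 -> vanishes W n.+1 -> vanishes (V `&` W) n ->
  vanishes (V `|` W) n.+1.
Proof.
move=> oV oW vV vW vVW z zc.
have zcV : cocycle_on V z by move=> s sV; apply: zc => t; left.
have zcW : cocycle_on W z by move=> s sW; apply: zc => t; right.
have [a aE] := vV z zcV; have [b bE] := vW z zcW.
case: n vV vW vVW z zc zcV zcW a aE b bE => [|n] vV vW vVW z zc zcV zcW a aE b bE.
  (* In degree 0 the primitives are constants; they agree, both being the value of [z] at a common
     point. *)
  have [y [Vy Wy]] := vVW.
  have ab : a = b.
    by rewrite -[a](aE (const_singular R 0 y)) // (bE (const_singular R 0 y)).
  exists a => s sVW; have [sV|sW] := sVW (vertex R ord0).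
    by apply: aE => t; rewrite (simplex0_eq t (vertex R ord0)).
  by rewrite ab; apply: bE => t; rewrite (simplex0_eq t (vertex R ord0)).
have abc : cocycle_on (V `&` W) (fun s => a s - b s).
  move=> s sVW; rewrite coboundaryB.
  have /= <- := aE s (fun t => (sVW t).1).
  by have /= <- := bE s (fun t => (sVW t).2); rewrite subrr.
have [c cE] := vVW _ abc.
pose e s := if pselect (carried V s) then a s else b s + adelta c s.
have eV s : carried V s -> e s = a s by rewrite /e; case: pselect.
have eW s : carried W s -> e s = b s + adelta c s.
  rewrite /e; case: pselect => // sV sW; rewrite -cE; first by rewrite addrC subrK.
  by move=> t; split; [exact: sV|exact: sW].
have [|||b' b'E] := @small_simplices R K Y V W oV oW n
  (fun s => z s - coboundary e s).
- move=> s sV; rewrite (eq_coboundary_on eV) // aE // subrr //.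
- move=> s sW; rewrite (eq_coboundary_on eW) // coboundaryD coboundary_adelta.
  by rewrite addr0 bE // subrr.
- by move=> s sVW; rewrite coboundaryB coboundary_coboundary zc // subr0.
exists (fun s => e s + b' s) => s sVW.
by rewrite /= coboundaryD -b'E // addrC subrK.
Qed.

End Vanishing.

(** * Nerves of good families *)

Section Nerve.
Variables (R : realType) (K : comPzRingType) (Y : topologicalType) (I : finType).
Implicit Types (F : I -> set Y) (S T : {set I}).
Local Notation vanishes := (@vanishes R K Y).

Definition unionF F S : set Y := [set y | exists2 i, i \in S & F i y].
Definition interF F S : set Y := [set y | forall i, i \in S -> F i y].

(** A homological form of good covers, inherited by subfamilies and by the traces of the other
    members on a given one. *)
Definition good F S := (forall i, i \in S -> open (F i)) /\
  forall T, T \subset S -> T != finset.set0 -> interF F T !=set0 ->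
    forall n, vanishes (interF F T) n.

Lemma good_sub F S T : T \subset S -> good F S -> good F T.
Proof.
move=> TS [oF gF]; split=> [i iT|T' T'T]; first exact/oF/(fintype.subsetP TS).
by apply: gF; apply: fintype.subset_trans TS.
Qed.

Lemma unionF_open F S : good F S -> open (unionF F S).
Proof.
move=> [oF _]; have -> : unionF F S = \bigcup_(i in [set i | i \in S]) F i by [].
exact: bigcup_open.
Qed.

Lemma interF_setI F i0 T : T != finset.set0 ->
  interF (fun i => F i0 `&` F i) T = interF F (i0 |: T).
Proof.
move=> /finset.set0Pn[j jT]; apply/seteqP; split=> y yT.
  move=> i /finset.setU1P[->|iT]; first by have [] := yT j jT.
  by have [] := yT i iT.
by move=> i iT; split; apply: yT; rewrite !inE ?eqxx ?iT ?orbT.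
Qed.

Lemma good_setI F S i0 : i0 \in S -> good F S ->
  good (fun i => F i0 `&` F i) (S :\ i0).
Proof.
move=> i0S [oF gF]; split=> [i /finset.setD1P[_ iS]|T TS T0].
  by apply: openI; exact: oF.
rewrite interF_setI //; apply: gF.
  rewrite finset.subUset finset.sub1set i0S.
  exact/(fintype.subset_trans TS)/finset.subsetDl.
by apply/finset.set0Pn; exists i0; exact: finset.setU11.
Qed.

Lemma unionF_setD1 F S i0 : i0 \in S -> unionF F S = F i0 `|` unionF F (S :\ i0).
Proof.
move=> i0S; apply/seteqP; split=> y /=.
  move=> [i iS yi]; have [<-|ii0] := eqVneq i i0; first by left.
  by right; exists i; rewrite // !inE ii0.
by move=> [yi|[i /finset.setD1P[_ iS] yi]]; [exists i0|exists i].
Qed.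

Lemma setI_unionF F S i0 : F i0 `&` unionF F S = unionF (fun i => F i0 `&` F i) S.
Proof.
apply/seteqP; split=> y /=; first by move=> [y0 [i iS yi]]; exists i.
by move=> [i iS [y0 yi]]; split=> //; exists i.
Qed.

Lemma vanishes_member F S i0 n : good F S -> i0 \in S -> vanishes (F i0) n.+1.
Proof.
move=> [oF gF] i0S; have [F0|] := pselect (F i0 !=set0); last first.
  by move=> /set0P/negP; rewrite negbK => /eqP ->; exact: vanishes_set0.
have -> : F i0 = interF F [set i0].
  apply/seteqP; split=> [y yi i /finset.set1P -> //|y]; apply.
  exact: finset.set11.
apply: gF; first by rewrite finset.sub1set.
  by apply/finset.set0Pn; exists i0; exact: finset.set11.
by have [y yi] := F0; exists y => i /finset.set1P ->.
Qed.

(** The inductive step of all the nerve arguments: one member is split off by Mayer-Vietoris, and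
    its intersection with the rest is the union of the traces on it, one degree lower. *)
Lemma vanishes_step F S i0 n : good F S -> i0 \in S ->
  vanishes (unionF F (S :\ i0)) n.+1 ->
  vanishes (unionF (fun i => F i0 `&` F i) (S :\ i0)) n ->
  vanishes (unionF F S) n.+1.
Proof.
move=> gF i0S v1 v2; rewrite (unionF_setD1 _ i0S); apply: mayer_vietoris => //.
- by have [oF _] := gF; exact: oF.
- by apply/unionF_open/good_sub/gF/finset.subsetDl.
- exact: vanishes_member gF i0S.
- by rewrite setI_unionF.
Qed.

Lemma unionF_set0 F : unionF F finset.set0 = set0.
Proof. by apply/seteqP; split=> y // [i]; rewrite inE. Qed.

(** Both the remaining members and their traces on [i0] still contain the common point. *)
Lemma vanishes_simplex F S n : good F S -> S != finset.set0 ->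
  interF F S !=set0 -> vanishes (unionF F S) n.
Proof.
move sS : #|S| => k; elim: k F S n sS => [|k IH] F S n sS gF.
  by move/eqP: sS; rewrite finset.cards_eq0 => ->.
move=> /finset.set0Pn[i0 i0S] [y yS]; case: n => [|n].
  by exists y; exists i0 => //; exact: yS.
have [S0|S0] := eqVneq (S :\ i0) finset.set0.
  rewrite (unionF_setD1 _ i0S) S0 unionF_set0 setU0.
  exact: vanishes_member gF i0S.
have sS' : #|S :\ i0| = k by move: sS; rewrite (finset.cardsD1 i0) i0S => -[].
apply: (vanishes_step gF i0S).
  apply: IH => //; first exact/good_sub/gF/finset.subsetDl.
  by exists y => i /finset.setD1P[_ iS]; exact: yS.
apply: IH => //; first exact: good_setI.
by exists y => i /finset.setD1P[_ iS]; split; exact: yS.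
Qed.

(** The nerve has dimension less than [m]. In the induction, traces on [i0] with a common point
    give, together with [i0], one more member with a common point, so the bound drops with the
    degree. *)
Lemma vanishes_dim F S m : good F S ->
  (forall T, T \subset S -> #|T| = m.+1 -> ~ (interF F T !=set0)) ->
  vanishes (unionF F S) m.+1.
Proof.
move sS : #|S| => k; elim: k F S m sS => [|k IH] F S m sS gF noT.
  move/eqP: sS; rewrite finset.cards_eq0 => /eqP ->; rewrite unionF_set0.
  exact: vanishes_set0.
have [i0 i0S] : exists i0, i0 \in S by apply/card_gt0P; rewrite sS.
have sS' : #|S :\ i0| = k by move: sS; rewrite (finset.cardsD1 i0) i0S => -[].
case: m noT => [|m] noT.
  rewrite (_ : unionF F S = set0); first exact: vanishes_set0.
  apply/seteqP; split=> // y [i iS yi]; apply: (noT (finset.set1 i)).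
  - by rewrite finset.sub1set.
  - by rewrite cards1.
  - by exists y => j /finset.set1P ->.
apply: (vanishes_step gF i0S).
  apply: IH => //; first exact/good_sub/gF/finset.subsetDl.
  by move=> T TS; apply: noT; apply: fintype.subset_trans TS (finset.subsetDl _ _).
apply: IH => //; first exact: good_setI.
move=> T TS sT; rewrite interF_setI; last by rewrite -finset.cards_eq0 sT.
apply: noT.
  rewrite finset.subUset finset.sub1set i0S.
  exact/(fintype.subset_trans TS)/finset.subsetDl.
rewrite finset.cardsU1 sT; case: (boolP (i0 \in T)) => // /(fintype.subsetP TS).
by rewrite !inE eqxx.
Qed.

(* Under these hypotheses the nerve is the boundary of the [b]-simplex. *)
Lemma vanishes_sphere F S a b : good F S -> #|S| = b.+1 ->
  ~ vanishes (unionF F S) b -> ~ vanishes (unionF F S) a -> a = b.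
Proof.
elim: b a F S => [|b IH] a F S gF sS nb na.
  case: a na => // a; move: nb => /= /set0P/negP; rewrite negbK => /eqP ->.
  by case; exact: vanishes_set0.
have [T [TS sT IT]] : exists T, [/\ T \subset S, #|T| = b.+1 & interF F T !=set0].
  apply: contrapT => noT; apply: nb; apply: vanishes_dim => // T TS sT IT.
  by apply: noT; exists T.
have /card_gt0P[i0 /finset.setDP[i0S i0T]] : (0 < #|S :\: T|)%N.
  by rewrite finset.cardsD (finset.setIidPr TS) sT sS subSnn.
have TE : T = S :\ i0.
  apply/eqP; rewrite eqEcard sT; apply/andP; split.
    apply/fintype.subsetP => i iT; rewrite !inE (fintype.subsetP TS) // andbT.
    by apply: contraNneq i0T => <-.
  by move: sS; rewrite (finset.cardsD1 i0) i0S add1n => -[->].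
have T0 : T != finset.set0 by rewrite -finset.cards_eq0 sT.
have gT : good F T by exact: good_sub gF.
have vT n : vanishes (unionF F T) n by exact: vanishes_simplex.
case: a na => [|a] na.
  case: na; have [y [i iT yi]] := vT 0%N; exists y; exists i => //.
  exact: (fintype.subsetP TS).
(* The members other than [i0] have an acyclic union, so both failures of vanishing pass to the
   traces on [i0], one degree lower. *)
congr _.+1; rewrite TE in vT sT.
apply: (IH _ (fun i => F i0 `&` F i) (S :\ i0)) => //.
- exact: good_setI.
- by move=> v; apply/nb/(vanishes_step gF i0S).
- by move=> v; apply/na/(vanishes_step gF i0S).
Qed.

End Nerve.

(** * Relative cup products *)

Section CupProducts.
Variables (R : realType) (K : comPzRingType) (Y : topologicalType).
Implicit Types A V W : set Y.
Local Notation cochain := (cochain R K Y).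
Local Notation coboundary := (@coboundary R K Y _).
Local Notation cocycle_on := (@cocycle_on R K Y).
Local Notation cob_on := (@cob_on R K Y).

(* The degree [n] of the product is a parameter, meant to be [p + q], so as to
   avoid casts along equalities between degrees. *)
Definition cupn n p q (u : cochain p) (v : cochain q) : cochain n :=
  fun s => lcup p (ev u s) (ev v s) (verts R n).
Arguments cupn n {p q} u v s.

Lemma map_lcup (P Q : Type) (f : P -> Q) p (phi psi : seq Q -> K) l :
  lcup p phi psi (map f l) = lcup p (phi \o map f) (psi \o map f) l.
Proof. by rewrite /lcup /= map_take map_drop. Qed.

Lemma ev_cupn n p q (u : cochain p) (v : cochain q) m (s : singular R Y m) l :
  size l = n.+1 -> ev (cupn n u v) s l = lcup p (ev u s) (ev v s) l.
Proof.
move=> sl; rewrite [LHS]/pull sl eqxx /cupn -[in RHS](map_aff_verts sl) map_lcup.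
by rewrite /lcup /= !ev_sing.
Qed.

Lemma coboundary_cupn n p q (u : cochain p) (v : cochain q) s : n = (p + q)%N ->
  coboundary (cupn n u v) s =
  cupn n.+1 (coboundary u) v s + (-1) ^+ p * cupn n.+1 u (coboundary v) s.
Proof.
move=> npq; rewrite coboundaryE.
rewrite (eq_ldelta (size_verts R n.+1) (@ev_cupn n p q u v _ s)).
rewrite ldelta_lcup; last first.
  by rewrite size_verts !ltnS npq leq_addr.
have evE k (c : cochain k) : ev (coboundary c) s = ldelta (ev c s).
  by apply/funext => l; rewrite ev_ldelta.
by rewrite /cupn !evE.
Qed.

Lemma cupn0l A n p q (u : cochain p) (v : cochain q) s :
  (forall s, carried A s -> u s = 0) -> carried A s -> cupn n u v s = 0.
Proof. by move=> u0 sA; rewrite /cupn /lcup (ev_eq0 _ u0 sA) mul0r. Qed.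

Lemma cupn0r A n p q (u : cochain p) (v : cochain q) s :
  (forall s, carried A s -> v s = 0) -> carried A s -> cupn n u v s = 0.
Proof. by move=> v0 sA; rewrite /cupn /lcup (ev_eq0 _ v0 sA) mulr0. Qed.

Lemma cupn_cocycle A n p q (u : cochain p) (v : cochain q) : n = (p + q)%N ->
  cocycle_on A u -> cocycle_on A v -> cocycle_on A (cupn n u v).
Proof.
move=> npq uc vc s sA; rewrite coboundary_cupn //.
by rewrite (@cupn0l _ _ _ _ _ _ _ uc sA) (@cupn0r _ _ _ _ _ _ _ vc sA) mulr0 addr0.
Qed.

Lemma ev_sub p (u v : cochain p) n (s : singular R Y n) l :
  ev (fun s => u s - v s) s l = ev u s l - ev v s l.
Proof. by rewrite /pull; case: eqP; rewrite ?subr0. Qed.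

Lemma cocycle_on_sub A V p (u : cochain p) : A `<=` V ->
  cocycle_on V u -> cocycle_on A u.
Proof. by move=> AV uc s sA; apply/uc/(carried_sub AV). Qed.

(** Changing [u] and [v] by coboundaries makes [u'] vanish on [V] and [v'] on [W]. Their product
    then vanishes on small simplices, hence is a coboundary by [small_simplices]. *)
Lemma relative_cup V W n p q (u : cochain p.+1) (v : cochain q.+1) :
  open V -> open W -> n = (p.+1 + q.+1)%N ->
  cocycle_on (V `|` W) u -> cocycle_on (V `|` W) v ->
  cob_on V u -> cob_on W v -> cob_on (V `|` W) (cupn n u v).
Proof.
move=> oV oW; case: n => // n [->] {n} uc vc [b /= ub] [c /= vc'].
set n := (p + q.+1)%N.
pose u' := (fun s => u s - coboundary b s) : cochain p.+1.
pose v' := (fun s => v s - coboundary c s) : cochain q.+1.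
have u'c : cocycle_on (V `|` W) u'.
  by move=> s sA; rewrite coboundaryB uc // coboundary_coboundary subr0.
have v'c : cocycle_on (V `|` W) v'.
  by move=> s sA; rewrite coboundaryB vc // coboundary_coboundary subr0.
have u'V s : carried V s -> u' s = 0 by move=> /ub; rewrite /u' => ->; rewrite subrr.
have v'W s : carried W s -> v' s = 0 by move=> /vc'; rewrite /v' => ->; rewrite subrr.
have [|||d dE] := @small_simplices R K Y V W oV oW n (cupn n.+1 u' v').
- by move=> s; exact: cupn0l.
- by move=> s; exact: cupn0r.
- exact: cupn_cocycle.
(* The difference of the products [u v] and [u' v'] is [(u - u') v + u' (v - v')], whose terms have
   primitives [b v] and, up to sign, [u' c]. The double negation lets [coboundaryB] do all the
   work. *)
exists (fun s => d s - (- cupn n b v s - (-1) ^+ p.+1 * cupn n u' c s)) => s sA /=.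
rewrite coboundaryB coboundaryB -dE //.
have bE : coboundary (fun s => - cupn n b v s) s = - coboundary (cupn n b v) s.
  by rewrite /Defs.coboundary -sumrN; apply: eq_bigr => j _; rewrite mulrN.
have cE : coboundary (fun s => (-1) ^+ p.+1 * cupn n u' c s) s =
    (-1) ^+ p.+1 * coboundary (cupn n u' c) s.
  by rewrite /Defs.coboundary mulr_sumr; apply: eq_bigr => j _; rewrite mulrCA.
rewrite bE cE !coboundary_cupn //; last by rewrite /n addSnnS.
rewrite (@cupn0r _ _ _ _ _ _ _ vc sA) (@cupn0l _ _ _ _ _ _ _ u'c sA).
rewrite add0r mulr0 addr0 mulrA.
rewrite -expr2 sqrr_sign mul1r /cupn /lcup !ev_sub; ring.
Qed.

Definition factor := {p : nat & cochain p}.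
Implicit Types (w : factor) (xs : seq factor).

Definition degree w := projT1 w.
Definition degrees xs := map degree xs.

(** Degrees stay out of the type, so that a factor can be split off at either end without casts. *)
Fixpoint lprod xs n (s : singular R Y n) (l : seq (std_simplex R n)) : K :=
  if xs is w :: xs' then lcup (degree w) (ev (projT2 w) s) (@lprod xs' n s) l
  else 1.

Definition prod_cochain xs n : cochain n := fun s => lprod xs s (verts R n).
Arguments prod_cochain xs n s : clear implicits.

Fixpoint cocycles_on A xs :=
  if xs is w :: xs' then cocycle_on A (projT2 w) /\ cocycles_on A xs' else True.

Lemma lprod_sing xs n (s : singular R Y n) m l l' :
  lprod xs (sing s m l) l' = lprod xs s (map (@aff R m n l) l').
Proof.
elim: xs l' => //= w xs IH l'.
by rewrite map_lcup /lcup /= ev_sing IH.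
Qed.

Lemma lprod_ev xs q n (s : singular R Y n) l : size l = q.+1 ->
  lprod xs s l = ev (prod_cochain xs q) s l.
Proof.
by move=> sl; rewrite /pull sl eqxx /prod_cochain lprod_sing map_aff_verts.
Qed.

Lemma prod_cochain_cons w xs n q : n = (degree w + q)%N ->
  prod_cochain (w :: xs) n = cupn n (projT2 w) (prod_cochain xs q).
Proof.
move=> nE; apply/funext => s; rewrite /prod_cochain /cupn /= /lcup; congr (_ * _).
by apply: lprod_ev; rewrite size_drop size_verts nE -addnS addKn.
Qed.

(** Associativity holds strictly at the level of cochains, so a product nested to the right also
    splits at its last factor. *)
Lemma lprod_rcons xs w n (s : singular R Y n) l :
  size l = (sumn (degrees xs) + degree w).+1 ->
  lprod (rcons xs w) s l =
  lcup (sumn (degrees xs)) (lprod xs s) (ev (projT2 w) s) l.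
Proof.
elim: xs l => [|x xs IH] l sl.
  by rewrite /= /lcup /= drop0 mul1r mulr1 take_oversize ?sl.
rewrite [LHS]/= {1}/lcup IH; last by rewrite size_drop sl /= -addnA -addnS addKn.
rewrite /lcup /= mulrA /lcup take_drop drop_drop addSn addnC.
congr (_ * _ * _).
by rewrite take_takel // ltnS leq_addr.
Qed.

Lemma prod_cochain_rcons w xs n q : q = sumn (degrees xs) -> n = (q + degree w)%N ->
  prod_cochain (rcons xs w) n = cupn n (prod_cochain xs q) (projT2 w).
Proof.
move=> qE nE; apply/funext => s.
rewrite /prod_cochain /cupn lprod_rcons -?qE; last first.
  by rewrite size_verts nE.
rewrite /lcup; congr (_ * _); apply: lprod_ev.
by rewrite size_takel // size_verts ltnS nE leq_addr.
Qed.

Lemma prod_cochain_cocycle A xs n : n = sumn (degrees xs) -> cocycles_on A xs ->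
  cocycle_on A (prod_cochain xs n).
Proof.
elim: xs n => [|w xs IH] n nE; last first.
  move=> [wc xc]; rewrite (prod_cochain_cons _ nE); apply: cupn_cocycle => //.
  exact: IH.
move=> _ s _; rewrite nE in s *.
by rewrite /Defs.coboundary -mulr_suml sum_sign mul0r.
Qed.

(* The empty product is the unit, whose restriction to [A] vanishes when [A] is
   empty or the ring is trivial. *)
Definition trivial_on A xs :=
  if xs is _ :: _ then
    forall n, n = sumn (degrees xs) -> cob_on A (prod_cochain xs n)
  else A !=set0 -> (1 : K) = 0.

Lemma trivial_cons V W w xs : open V -> open W ->
  all (fun d => 0 < d)%N (degrees (w :: xs)) -> cocycles_on (V `|` W) (w :: xs) ->
  cob_on V (projT2 w) -> trivial_on W xs -> trivial_on (V `|` W) (w :: xs).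
Proof.
move=> oV oW; case: w => -[//|p] u /= xs0 [uc xsc] uV xsW n nE.
case: xs xs0 xsc xsW nE => [|x xs] xs0 xsc xsW nE; last first.
  case qE : (sumn (degrees (x :: xs))) => [|q].
    by move: xs0 qE => /= /andP[]; case: (degree x).
  rewrite qE in nE; rewrite (@prod_cochain_cons (existT _ p.+1 u) _ _ q.+1 nE).
  apply: relative_cup => //=.
    exact: prod_cochain_cocycle.
  exact: xsW.
have {}nE : n = p.+1 by rewrite nE addn0.
(* With a single factor, triviality of the unit on [W] leaves two cases: 1 = 0 in [K], or [W] is
   empty and the union is [V]. *)
subst n; have [W0|/set0P/negP] := pselect (W !=set0); last first.
  rewrite negbK => /eqP ->; rewrite setU0; have [b bE] := uV.
  exists b => s sV.
  rewrite -bE // /prod_cochain /= /lcup mulr1 take_oversize ?size_verts //.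
  exact: ev_verts.
exists (fun=> 0) => s _; rewrite -[LHS]mul1r -[RHS]mul1r.
by rewrite (xsW W0) !mul0r.
Qed.

Lemma trivial_rcons V W w xs : open V -> open W ->
  all (fun d => 0 < d)%N (degrees (rcons xs w)) ->
  (0 < size xs)%N -> cocycles_on (V `|` W) xs ->
  cocycle_on (V `|` W) (projT2 w) ->
  cob_on V (projT2 w) -> trivial_on W xs -> trivial_on (V `|` W) (rcons xs w).
Proof.
case: xs => // x xs oV oW pos _ xsc wc wV xsW.
suff H n : n = sumn (degrees (rcons (x :: xs) w)) ->
  cob_on (V `|` W) (prod_cochain (rcons (x :: xs) w) n) by exact: H.
case: w pos wc wV => -[|p] u; first by rewrite /degrees map_rcons all_rcons.
move=> pos uc uV; rewrite /degrees map_rcons sumn_rcons -/(degrees _) => nE.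
case qE : (sumn (degrees (x :: xs))) nE => [|q] nE.
  by move: pos qE => /= /andP[]; case: (degree x).
(* The left operand is now the shorter product, trivial on [W], so the two open sets are
   exchanged. *)
rewrite (@prod_cochain_rcons (existT _ p.+1 u) _ _ q.+1 (esym qE) nE) setUC.
apply: relative_cup => //=; rewrite 1?setUC //.
  by apply: prod_cochain_cocycle; rewrite ?qE.
by apply: xsW; rewrite qE.
Qed.

Lemma cocycles_on_sub A V xs : A `<=` V -> cocycles_on V xs -> cocycles_on A xs.
Proof.
move=> AV; elim: xs => //= w xs IH [wc xsc].
by split; [exact: cocycle_on_sub wc|exact: IH].
Qed.

Lemma cocycles_on_rcons A xs w :
  cocycles_on A (rcons xs w) -> cocycles_on A xs /\ cocycle_on A (projT2 w).
Proof.
elim: xs => [[]//|x xs IH] /= [xc /IH[xsc wc]].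
by split.
Qed.

End CupProducts.
Arguments cupn {R K Y} n {p q} u v s.
Arguments prod_cochain {R K Y} xs n s.

(** * Lower bounds on the size of good covers *)

(** Each round of peeling removes one member more than the current total degree; the final 1 is the
    member that must remain for the empty product. *)
Fixpoint weight (d : seq nat) : nat :=
  if d is a :: d' then ((a + sumn d').+1 + weight d')%N else 1.

Section CoverBounds.
Variables (R : realType) (K : comPzRingType) (Y : topologicalType) (I : finType).
Variable F : I -> set Y.
Implicit Types (S T : {set I}) (xs : seq (factor R K Y)) (w : factor R K Y).
Local Notation positive xs := (all (fun d => 0 < d)%N (degrees xs)).
Local Notation good := (@good R K Y I F).

Definition essential S xs :=
  [/\ positive xs, cocycles_on (unionF F S) xs & ~ trivial_on (unionF F S) xs].

Lemma unionF_sub S T : T \subset S -> unionF F T `<=` unionF F S.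
Proof. by move=> TS y [i iT yi]; exists i => //; exact: (fintype.subsetP TS). Qed.

Lemma unionF_split S T : T \subset S ->
  unionF F S = unionF F T `|` unionF F (S :\: T).
Proof.
move=> TS; apply/seteqP; split=> y.
  move=> [i iS yi]; case: (boolP (i \in T)) => iT; first by left; exists i.
  by right; exists i; rewrite // inE iT.
by move=> []; apply: unionF_sub; rewrite ?finset.subsetDl.
Qed.

Lemma essential_not_vanishes S w xs : essential S (w :: xs) ->
  ~ vanishes R K (unionF F S) (sumn (degrees (w :: xs))).+1.
Proof.
move=> [pos xsc nt] v; apply: nt => n ->; apply: v.
exact: prod_cochain_cocycle.
Qed.

Lemma essential_simplex S w xs : good S -> essential S (w :: xs) ->
  exists T, [/\ T \subset S, #|T| = (sumn (degrees (w :: xs))).+1 &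
    forall n, vanishes R K (unionF F T) n].
Proof.
move=> gS ess; apply: contrapT => noT; apply: (essential_not_vanishes ess).
apply: vanishes_dim => // T TS sT IT; apply: noT; exists T; split=> // n.
apply: vanishes_simplex => //; first exact: good_sub gS.
by rewrite -cards_eq0 sT.
Qed.

Lemma vanishes_cob S T w : T \subset S ->
  (forall n, vanishes R K (unionF F T) n) ->
  cocycle_on (unionF F S) (projT2 w) -> cob_on (unionF F T) (projT2 w).
Proof.
move=> TS vT wc; apply: (vT (degree w).+1).
exact: cocycle_on_sub (unionF_sub TS) wc.
Qed.

Lemma essential_behead S T w xs : good S -> T \subset S ->
  (forall n, vanishes R K (unionF F T) n) -> essential S (w :: xs) ->
  essential (S :\: T) xs.
Proof.
move=> gS TS vT [pos xsc nt]; split; first by case/andP: pos.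
  by case: xsc => _; apply: cocycles_on_sub; apply/unionF_sub/finset.subsetDl.
move=> tr; apply: nt; rewrite (unionF_split TS).
apply: trivial_cons => //.
- exact: unionF_open (good_sub TS gS).
- exact: unionF_open (good_sub (finset.subsetDl S T) gS).
- by rewrite -unionF_split.
- by apply: vanishes_cob TS vT _; case: xsc.
Qed.

Lemma essential_belast S T w xs : good S -> T \subset S -> (0 < size xs)%N ->
  (forall n, vanishes R K (unionF F T) n) -> essential S (rcons xs w) ->
  essential (S :\: T) xs.
Proof.
move=> gS TS xs0 vT [pos /cocycles_on_rcons[xsc wc] nt]; split.
- by move: pos; rewrite /degrees map_rcons all_rcons => /andP[].
- by apply: cocycles_on_sub xsc; apply/unionF_sub/finset.subsetDl.
move=> tr; apply: nt; rewrite (unionF_split TS).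
apply: trivial_rcons => //.
- exact: unionF_open (good_sub TS gS).
- exact: unionF_open (good_sub (finset.subsetDl S T) gS).
- by rewrite -unionF_split.
- by rewrite -unionF_split.
- exact: vanishes_cob TS vT wc.
Qed.

Lemma weight_le xs S : good S -> essential S xs -> (weight (degrees xs) <= #|S|)%N.
Proof.
elim: xs S => [|w xs IH] S gS ess.
  (* The unit is trivial on the empty set, so some member is left. *)
  case: ess => _ _ nt; rewrite card_gt0; apply: contra_notN nt => /eqP ->.
  by rewrite unionF_set0 => -[].
have [T [TS sT vT]] := essential_simplex gS ess.
have := IH _ (good_sub (finset.subsetDl S T) gS) (essential_behead gS TS vT ess).
have := cardsD S T; rewrite (finset.setIidPr TS) sT => ->.
by have := subset_leq_card TS; rewrite sT /=; lia.
Qed.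

(** The removed simplex is always chosen for [xs], so the count follows the constant degrees; [ys]
    loses its last factor meanwhile and keeps the degree [a] to the end. *)
Lemma weight_nseq_lt a b k xs ys S : good S -> a != b ->
  degrees xs = nseq k.+1 b -> degrees ys = a :: nseq k b ->
  essential S xs -> essential S ys -> (weight (nseq k.+1 b) < #|S|)%N.
Proof.
move=> gS ab; elim: k S gS xs ys => [|k IH] S gS xs ys dx dy ex ey.
  (* In case of equality [S] has [b.+2] members, with cohomology in degrees [a] and [b]; the index
     in [vanishes] is the degree plus one. *)
  have := weight_le gS ex; rewrite dx leq_eqVlt => /predU1P[|//].
  case: xs ys dx dy ex ey => [//|x xs] [//|y ys] dx dy ex ey.
  have := essential_not_vanishes ex; have := essential_not_vanishes ey.
  rewrite dx dy /= !addn0 addn1 => na nb sS.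
  have [ab'] := @vanishes_sphere _ _ _ _ _ _ a.+1 b.+1 gS (esym sS) nb na.
  by rewrite ab' eqxx in ab.
case: xs dx ex => [//|x xs] [xb dx] ex.
have [T [TS sT vT]] := essential_simplex gS ex.
have [y [ys' ysE]] : exists y ys', ys = rcons ys' y.
  by case/lastP: ys {dy ey} (congr1 size dy) => // ys' y _; exists y, ys'.
have dy' : degrees ys' = a :: nseq k b.
  move: dy; rewrite ysE /degrees map_rcons -cat1s -[nseq k.+1 b]/(nseq (1 + k) b).
  by rewrite addnC nseqD catA cats1 => /rcons_inj[].
have ys0 : (0 < size ys')%N by case: (ys') dy'.
rewrite ysE in ey.
have := IH _ (good_sub (finset.subsetDl S T) gS) _ _ dx dy'
  (essential_behead gS TS vT ex) (essential_belast gS TS ys0 vT ey).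
have := cardsD S T; rewrite (finset.setIidPr TS) sT => ->.
have := subset_leq_card TS; rewrite sT /= xb dx /=.
by lia.
Qed.

Lemma weight_lt xs S : good S -> essential S xs ->
  (forall b, degrees xs <> nseq (size xs) b) -> (weight (degrees xs) < #|S|)%N.
Proof.
elim: xs S => [|w xs IH] S gS ess nc; first by case: (nc 0%N).
have [T [TS sT vT]] := essential_simplex gS ess.
have gST := good_sub (finset.subsetDl S T) gS.
have essD := essential_behead gS TS vT ess.
(* The removal of [T] pays for the first term of the weight. *)
suff : (weight (degrees xs) < #|S :\: T|)%N.
  have := cardsD S T; rewrite (finset.setIidPr TS) sT => ->.
  by have := subset_leq_card TS; rewrite sT /=; lia.
have [[b bE]|nb] := pselect (exists b, degrees xs = nseq (size xs) b); last first.
  by apply: IH => // b bE; apply: nb; exists b.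
case: xs IH ess nc sT essD bE => [|x xs] IH ess nc sT essD bE.
  by case: (nc (degree w)).
rewrite bE; have wb : degree w != b.
  apply/eqP => wb; apply: (nc b).
  by rewrite -[LHS]/(degree w :: degrees (x :: xs)) bE wb.
(* Dropping the last factor instead of the first gives a second product, with degrees
   [degree w, b, ..., b], essential on the same remaining members. *)
have [z [zs zsE]] : exists z zs, w :: x :: xs = rcons zs z.
  by exists (last x xs), (belast w (x :: xs)); rewrite -lastI.
have dz : degrees zs = degree w :: nseq (size xs) b.
  have /(congr1 (fun s => degrees s)) := zsE.
  rewrite -[degrees (w :: _)]/(degree w :: degrees (x :: xs)) bE.
  rewrite /degrees map_rcons -cat1s.
  rewrite -[nseq (size _) _]/(nseq (1 + size xs) b) addnC nseqD catA cats1.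
  by move=> /rcons_inj[].
have zs0 : (0 < size zs)%N by case: (zs) dz.
rewrite zsE in ess.
exact: weight_nseq_lt wb bE dz essD (essential_belast gS TS zs0 vT ess).
Qed.

End CoverBounds.

(** * Covering types *)

(** The degree at index [k] is counted in each of the first [k.+1] rounds, and each round, like the
    final one, adds 1. *)
Lemma weightE d :
  weight d = (\sum_(k < size d) k.+1 * nth 0%N d k + (size d).+1)%N.
Proof.
elim: d => [|a d IH] /=; first by rewrite big_ord0.
rewrite IH sumnE (big_nth 0%N) big_mkord big_ord_recl.
rewrite [in RHS](eq_bigr (fun k : 'I__ => nth 0 d k + k.+1 * nth 0 d k)%N).
  rewrite [in RHS]big_split mul1n; set x := (\sum_(_ < _) _)%N.
  by set y := (\sum_(_ < _) _)%N; rewrite /=; lia.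
by move=> k _; rewrite lift0 mulSn.
Qed.

Section FactorLists.
Variables (R : realType) (K : comPzRingType) (X : topologicalType).

Fixpoint factors (i : seq nat) :
    (forall k : nat, cochain R K X (nth 0%N i k)) -> seq (factor R K X) :=
  match i return (forall k : nat, cochain R K X (nth 0%N i k)) -> _ with
  | [::] => fun _ => [::]
  | a :: i' => fun x => existT _ a (x 0%N) :: @factors i' (fun k => x k.+1)
  end.

Lemma degrees_factors i x : degrees (@factors i x) = i.
Proof. by elim: i x => //= a i IH x; rewrite IH. Qed.

Lemma cocycles_factors i x A :
  (forall k, (k < size i)%N -> is_cocycle (x k)) ->
  cocycles_on A (@factors i x).
Proof.
elim: i x => //= a i IH x xc; split; first by move=> s _; exact: (xc 0%N).
by apply: IH => k ki; exact: (xc k.+1).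
Qed.

Lemma cupE p q (b : cochain R K X p) (c : cochain R K X q) s :
  cup b c s = cupn (p + q) b c s.
Proof.
have sp : size (take p.+1 (verts R (p + q))) = p.+1.
  by rewrite size_takel // size_verts ltnS leq_addr.
have sq : size (drop p (verts R (p + q))) = q.+1.
  by rewrite size_drop size_verts -addnS addKn.
rewrite /cup /cupn /lcup /pull sp sq !eqxx.
congr (b _ * c _); apply: singular_mapE => i.
  rewrite nth_take ?ltn_ord //.
  have ip : (i < (p + q).+1)%N by rewrite (leq_trans (ltn_ord i)) // ltnS leq_addr.
  by rewrite -[in RHS](inordK ip) inordK // -(nth_verts R (inord i)) inordK.
have ip : (p + i < (p + q).+1)%N by rewrite ltnS leq_add2l -ltnS.
by rewrite nth_drop -(nth_verts R (inord (p + i))) inordK.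
Qed.

Lemma cup_prodE i x s :
  @cup_prod R K X i x s = prod_cochain (@factors i x) (sumn i) s.
Proof.
elim: i x s => [//|a i IH] x s.
rewrite [LHS]cupE (@prod_cochain_cons _ _ _ (existT _ a (x 0%N)) _ _ (sumn i)) //=.
by congr (cupn _ _ _ _); apply/funext => s'; exact: IH.
Qed.

(** Positivity matters: in degree 0, [cob_on] is reduced and accepts constants, whereas
    [is_coboundary] requires 0. *)
Lemma cob_on_is_coboundary n (c : cochain R K X n) : (0 < n)%N ->
  cob_on [set: X] c -> is_coboundary c.
Proof. by case: n c => // n c _ [b bE]; exists b => s; exact: bE. Qed.

End FactorLists.

(** * Transport of products along homotopy equivalences *)

Section Pullback.
Variables (R : realType) (K : comPzRingType) (X Y : topologicalType).
Variables (f : Y -> X) (fc : continuous f).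

Definition push_singular n (s : singular R Y n) : singular R X n :=
  mkcts (fun t => continuous_comp (@singular_continuous _ _ _ s t) (@fc (s t))).

Definition pullback_cochain n (u : cochain R K X n) : cochain R K Y n :=
  fun s => u (push_singular s).

Definition pullback (w : factor R K X) : factor R K Y :=
  existT _ (projT1 w) (pullback_cochain (projT2 w)).

Lemma coboundary_pullback n (u : cochain R K X n) s :
  coboundary (pullback_cochain u) s = coboundary u (push_singular s).
Proof.
apply: eq_bigr => j _; congr (_ * u _).
exact/continuousEP.
Qed.

Lemma lprod_pullback xs n (s : singular R Y n) l :
  lprod (map pullback xs) s l = lprod xs (push_singular s) l.
Proof.
elim: xs l => //= w xs IH l; rewrite /lcup IH; congr (_ * _).
rewrite /pull; case: eqP => // _; congr (projT2 w _).
exact/continuousEP.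
Qed.

Lemma degrees_pullback xs : degrees (map pullback xs) = degrees xs.
Proof. by rewrite /degrees -map_comp. Qed.

Lemma cocycles_pullback xs : cocycles_on setT xs ->
  cocycles_on setT (map pullback xs).
Proof.
elim: xs => //= w xs IH [wc xsc]; split; last exact: IH.
by move=> s _; rewrite coboundary_pullback wc.
Qed.

End Pullback.

(** Pulling back along [g] a primitive of the product on [Y] gives one for the product pulled back
    along [f \o g], which differs from the product on [X] by a coboundary coming from the
    homotopy. *)
Lemma essential_pullback (R : realType) (K : comPzRingType)
    (X Y : topologicalType) (f : Y -> X) (g : X -> Y) (fc : continuous f)
    (gc : continuous g) (xs : seq (factor R K X)) n :
  homotopic R (f \o g) id -> n = sumn (degrees xs) -> (0 < n)%N ->
  cocycles_on setT xs ->
  cob_on setT (prod_cochain (map (pullback fc) xs) n) ->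
  cob_on setT (prod_cochain xs n).
Proof.
move=> [H [Hc H0 H1]]; case: n => // n nE _ xsc [b bE].
have zc : is_cocycle (prod_cochain xs n.+1).
  by move=> s; exact: (prod_cochain_cocycle nE xsc).
have [c cE] := homotopy_cochain Hc H0 H1 zc.
exists (fun s => c s - (- pullback_cochain gc b s)) => s _ /=.
rewrite coboundaryB -(cE s (push_singular fc (push_singular gc s)) s) //.
have -> : coboundary (fun s => - pullback_cochain gc b s) s =
    - coboundary b (push_singular gc s).
  rewrite -coboundary_pullback /Defs.coboundary -sumrN.
  by apply: eq_bigr => j _; rewrite mulrN.
have := bE (push_singular gc s); rewrite /= /prod_cochain lprod_pullback => <- //.
by rewrite opprK subrK.
Qed.

Lemma good_cover_family (R : realType) (K : comPzRingType) (Y : topologicalType)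
    (U : set (set Y)) k : good_cover R U -> (U #= `I_k)%card ->
  exists F : 'I_k -> set Y,
    good R K F finset.setT /\ unionF F finset.setT = [set: Y].
Proof.
move=> [oU cU _ iU] /card_esym/card_set_bijP[f [fU _ Uf]].
have FU (i : 'I_k) : U (f i) by apply: fU => /=.
exists (fun i => f i); split; last first.
  apply/seteqP; split=> // y _.
  have [A UA Ay] : (\bigcup_(A in U) A) y by rewrite cU.
  by have [i /= ik fiA] := Uf A UA; exists (Ordinal ik); rewrite ?inE //= fiA.
split=> [i _|T _ T0 IT n]; first exact/oU/FU.
(* A set of indices is turned into a finite subfamily of [U], to which the definition of a good
   cover applies. *)
pose V := [set A | exists2 i : 'I_k, i \in T & A = f i].
have VE : \bigcap_(A in V) A = interF (fun i : 'I_k => f i) T.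
  apply/seteqP; split=> y yV; first by move=> i iT; apply: yV; exists i.
  by move=> A [i iT ->]; exact: yV.
have cV : contractible R (interF (fun i : 'I_k => f i) T).
  rewrite -VE; apply: iU; last by rewrite VE.
  - by move=> A [i _ ->].
  - apply: (@sub_finite_set _ _ (range (fun i : 'I_k => f i))).
      by move=> A [i _ ->]; exists i.
    exact: finite_image.
  - by have [i iT] := finset.set0Pn _ T0; exists (f i), i.
by case: n => [//|n] z; exact: contractible_cob_on.
Qed.

Section Bound.
Variables (R : realType) (i : seq nat).
Hypotheses (i_gt0 : all (fun d => 0 < d)%N i) (i_neq0 : (0 < size i)%N).

Lemma cover_weight (X Y : topologicalType) (U : set (set Y)) k :
  essential_product R X i -> homotopy_equivalent R Y X ->
  good_cover R U -> (U #= `I_k)%card ->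
  (weight i <= k)%N /\
  ((forall b, i <> nseq (size i) b) -> (weight i < k)%N).
Proof.
move=> [K [x [xc nx]]] [f [g [fc gc _ fg]]] gU Uk.
have [F [gF cF]] := good_cover_family K gU Uk.
pose xs := map (pullback fc) (factors x).
have degs_xs : degrees xs = i by rewrite degrees_pullback degrees_factors.
have sumi : (0 < sumn i)%N.
  by case: (i) i_neq0 i_gt0 => //= a i' _ /andP[a0 _]; rewrite addn_gt0 a0.
have ess : essential F finset.setT xs.
  split; rewrite ?degs_xs // cF.
    by apply: cocycles_pullback; exact: cocycles_factors.
  move=> tr; apply: nx; apply: cob_on_is_coboundary => //.
  have := @essential_pullback R K X Y f g fc gc (factors x) (sumn i) fg.
  rewrite degrees_factors => /(_ erefl sumi (cocycles_factors _ xc)).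
  have xsi : cob_on setT (prod_cochain xs (sumn i)).
    have : xs <> [::] by move=> xs0; move: i_neq0; rewrite -degs_xs xs0.
    move: tr; case xsE : xs => [//|w ys] /= tr _.
    by apply: tr; rewrite -degs_xs xsE.
  move=> /(_ xsi)[b bE]; exists b => s sT.
  by rewrite cup_prodE bE.
have := weight_le gF ess; have := weight_lt gF ess.
rewrite degs_xs cardsT card_ord.
rewrite -(size_map (@degree R K Y) xs) -/(degrees xs) degs_xs.
by move=> *; split.
Qed.

(** The three nested infima reduce the bound to a single good cover of a space homotopy equivalent
    to one with an essential product. *)
Lemma ct_tuple_ge m :
  (forall (X Y : topologicalType) (U : set (set Y)) k,
    essential_product R X i -> homotopy_equivalent R Y X ->
    good_cover R U -> (U #= `I_k)%card -> (m <= k)%N) ->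
  (m%:R%:E <= ct_tuple R i)%E.
Proof.
move=> H; apply: le_ereal_inf_tmp => _ [X [_ ess ->]].
apply: le_ereal_inf_tmp => _ [Y [_ YX ->]].
apply: le_ereal_inf_tmp => _ [U [k [gU Uk ->]]].
by rewrite lee_fin ler_nat; exact: H ess YX gU Uk.
Qed.

End Bound.

Theorem theorem3p5 (R : realType) (n : nat) (i : n.-tuple nat)
    (hn : (0 < n)%N) (hi : forall k : 'I_n, (0 < tnth i k)%N) :
  ((((\sum_(k < n) k.+1 * tnth i k) + n.+1)%N%:R)%:E <= ct_tuple R i)%E /\
  (~ (forall j k : 'I_n, tnth i j = tnth i k) ->
   (((\sum_(k < n) k.+1 * tnth i k) + n.+2)%N%:R)%:E <= ct_tuple R i)%E.
Proof.
have i_gt0 : all (fun d => 0 < d)%N i.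
  by apply/all_tnthP => k; exact: hi.
have i_neq0 : (0 < size i)%N by rewrite size_tuple.
have weight_i : weight i = ((\sum_(k < n) k.+1 * tnth i k) + n.+1)%N.
  rewrite weightE size_tuple; congr (_ + _)%N.
  by apply: eq_bigr => k _; rewrite (tnth_nth 0%N).
split=> [|neq]; apply: ct_tuple_ge => X Y U k ess YX gU Uk;
  have [le lt] := cover_weight i_gt0 i_neq0 ess YX gU Uk.
  by rewrite -weight_i.
(* The extra unit is the strict inequality of [cover_weight], which asks that the degrees not be a
   constant list. *)
rewrite addnS -weight_i; apply: lt => b ib; apply: neq => j l.
have tnth_b (m : 'I_n) : tnth i m = b.
  by rewrite (tnth_nth 0%N) ib nth_nseq size_tuple ltn_ord.
by rewrite !tnth_b.
Qed.
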